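(* Any graph $G$ of orientable genus $1$ (i.e. embeddable on the torus) or of non-orientable genus $1$ (i.e. embeddable on the projective plane) is $2$-splittable (into a planar graph).
   Context: Graphs are finite and simple. For a positive integer $k$, a $k$-split operation at a vertex $v$ of a graph inserts at most $k$ new vertices $v_1,\dots,v_k$ (the copies of $v$), then, for each neighbor $w$ of $v$, adds at least one edge $(v_i,w)$ with $i\in[1,k]$, and finally deletes $v$ along with its incident edges. A $k$-split of a graph $G$ is a graph obtained by applying a $k$-split operation to each vertex of $G$ at most once. A graph $G$ is $k$-splittable if some $k$-split of $G$ is planar. *)

(* Defs.v *)
From HB Require Import structures.
From mathcomp Require Import all_boot all_order all_algebra.
From mathcomp Require Import all_classical all_reals all_analysis.

Set Implicit Arguments.
Unset Strict Implicit.
Unset Printing Implicit Defensive.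

Import Order.TTheory GRing.Theory Num.Theory.
Import numFieldNormedType.Exports.

Local Open Scope classical_set_scope.
Local Open Scope ring_scope.

Record sgraph := SGraph {
  vertex :> finType;
  adj : rel vertex;
  adj_sym : symmetric adj;
  adj_irr : irreflexive adj }.

Section Split.
Variables (G : sgraph) (v : G) (m : nat) (a : 'I_m -> pred G).

(* The result of deleting [v] and inserting [m] pairwise non-adjacent copies of
   it, the copy [i] being joined to the neighbours of [v] selected by [a i]. *)
Definition split_vertex : finType := ({u : G | u != v} + 'I_m)%type.

Definition split_adj (x y : split_vertex) : bool :=
  match x, y with
  | inl u, inl w => adj (val u) (val w)
  | inl u, inr i | inr i, inl u => adj v (val u) && a i (val u)
  | inr _, inr _ => false
  end.

Lemma split_adj_sym : symmetric split_adj.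
Proof. by move=> [u|i] [w|j] //=; rewrite adj_sym. Qed.

Lemma split_adj_irr : irreflexive split_adj.
Proof. by move=> [u|i] //=; rewrite adj_irr. Qed.

Definition split_graph : sgraph := SGraph split_adj_sym split_adj_irr.

(* Every neighbour of [v] is joined to at least one copy. *)
Definition split_covers : Prop :=
  forall w : G, adj v w -> exists i : 'I_m, a i w.

Definition split_keep (A : {set G}) : {set split_graph} :=
  [set x : split_vertex | if x is inl u then val u \in A else false].

End Split.

(* [splits k A H]: [H] arises from [G] by successive [k]-split operations, each
   at a vertex of [A] and at most once per vertex.  [A] is the set of vertices
   that may still be split; in particular, copies are never split again. *)
Inductive splits (k : nat) : forall G : sgraph, {set G} -> sgraph -> Prop :=
| splits_refl (G : sgraph) (A : {set G}) : splits k A G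
| splits_step (G : sgraph) (A : {set G}) (H : sgraph)
    (v : G) (m : nat) (a : 'I_m -> pred G) :
    v \in A -> (m <= k)%N -> split_covers v a ->
    splits k (split_keep v a A) H -> splits k A H.

Definition is_split (k : nat) (G H : sgraph) : Prop := splits k [set: G]%SET H.

(* A drawing of [G] in [X] without crossings: distinct points for the vertices
   and, for each edge, a simple arc between its endpoints, such that the
   interior of an arc meets neither a vertex nor the interior of another arc.
   An edge [xy] is drawn by [c x y], and by the reverse arc [c y x]. *)
Definition embeddable (R : realType) (X : topologicalType) (G : sgraph) : Prop :=
  exists (p : G -> X) (c : G -> G -> R -> X),
  [/\ injective p,
      forall x y, adj x y ->
        [/\ {within `[0, 1], continuous (c x y)},
            {in `[0, 1] &, injective (c x y)},
            c x y 0 = p x, c x y 1 = p y &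
            {in `[0, 1], forall t, c y x t = c x y (1 - t)}],
      forall x y z, adj x y -> {in `]0, 1[, forall t, c x y t <> p z} &
      forall x y x' y', adj x y -> adj x' y' ->
        {in `]0, 1[ &, forall s t, c x y s = c x' y' t ->
          (x' = x /\ y' = y) \/ (x' = y /\ y' = x)}].

Definition plane (R : realType) : topologicalType := 'rV[R]_2.

Definition sphere (R : realType) (n : nat) : set 'rV[R]_n.+1 :=
  [set x | \sum_i x ord0 i ^+ 2 = 1].
Arguments sphere : clear implicits.

Definition torus (R : realType) : topologicalType :=
  (set_type (sphere R 1) * set_type (sphere R 1))%type.

Section ProjectivePlane.
Variable R : realType.

Definition antipodal (x y : set_type (sphere R 2)) : bool :=
  (val x == val y) || (val x == - val y).

Lemma antipodal_refl : reflexive antipodal.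
Proof. by move=> x; rewrite /antipodal eqxx. Qed.

Lemma antipodal_sym : symmetric antipodal.
Proof.
by move=> x y; rewrite /antipodal eq_sym [val y == - _]eq_sym eqr_oppLR.
Qed.

Lemma antipodal_trans : transitive antipodal.
Proof.
move=> y x z /orP[]/eqP xy /orP[]/eqP yz; rewrite /antipodal xy yz ?opprK eqxx //.
all: by rewrite orbT.
Qed.

Canonical antipodal_equiv :=
  EquivRel antipodal antipodal_refl antipodal_sym antipodal_trans.

Definition projective_plane : topologicalType :=
  quotient_topology {eq_quot antipodal_equiv}%qT.

End ProjectivePlane.

Definition planar (R : realType) (G : sgraph) : Prop := embeddable R (plane R) G.

Definition splittable (R : realType) (k : nat) (G : sgraph) : Prop :=
  exists H : sgraph, is_split k G H /\ planar R H.

(* Main.v *)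
Require Import Defs.
From mathcomp Require Import all_boot all_order all_algebra.
From mathcomp Require Import all_classical all_reals all_analysis.
From mathcomp Require Import ring lra zify.

(** Let [H] be a graph that maps to [G] with fibres of at most two vertices, so
    that every edge of [G] is the image of an edge of [H].  Splitting each
    vertex of [G] into its fibre gives [H] ([splits_cover]), so it suffices to
    find such an [H] that is planar.  It is taken from a covering space of the
    surface: the arcs of [G] lift, and the lifts of arcs that do not cross do
    not cross ([embeddable_lift]).

    Over the projective plane the covering space is the sphere.  The two lifts
    of each vertex and of each edge form a graph on the sphere.  Every edge is
    covered twice, so one lift of one edge can be left out; projecting from a
    point in the middle of it draws the rest in the plane.

    The torus is the quotient of the plane by the lattice of integer points.
    After the choice of a lift of every vertex, each arc has a shift: the
    lattice vector by which the lift of the arc misses the chosen lift of its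
    end.  If the shifts along every closed walk add up to zero, the lifts can be
    chosen so that all shifts vanish ([potential_eq]), and [G] itself is drawn
    in the plane.  Otherwise a shortest closed walk of non-zero shift is simple.
    Let [c] be the primitive lattice vector in the direction of its shift.  The
    quotient of the plane by [c] is an annulus, and the height above [c]
    ([rise]) numbers the lifts of a vertex to this annulus by integers.  The
    lifts of the simple closed walk at different heights are disjoint.  A closed
    walk of total rise [h] must cross [h] consecutive ones, and it can do so
    only at vertices, one for each; hence it has at least [h] edges
    ([closed_walk_width]).

    This bound is the condition under which the lifts of the vertices can be
    renumbered so that every arc rises by [-1], [0] or [1]: the potential of
    [potential] exists when no closed walk has negative weight, and it is
    applied to the weight that adds [1] to the rise of each arc.  After that,
    the lifts numbered [0] and [1] of all vertices carry a lift of every edge,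
    and the exponential map draws them in the plane.

    That curves around the torus in independent directions meet
    ([closed_walks_meet]) comes down to two paths that join opposite sides of a
    rectangle ([paths_meet]), and this to the parity of the number of sign
    changes along the sides of the squares of a grid ([grid_sign_change]). *)

Set Implicit Arguments.
Unset Strict Implicit.
Unset Printing Implicit Defensive.

Import Order.TTheory GRing.Theory Num.Theory.
Import numFieldNormedType.Exports.

Local Open Scope classical_set_scope.
Local Open Scope ring_scope.

(** * Weights of walks *)

Section Walks.
Variables (T : eqType) (V : zmodType).
Implicit Types (e : rel T) (w : T -> T -> V) (x y : T) (p q r : seq T).

Fixpoint walk_weight w x p : V :=
  if p is y :: p' then w x y + walk_weight w y p' else 0.

Lemma walk_weight_cat w x p q :
  walk_weight w x (p ++ q) = walk_weight w x p + walk_weight w (last x p) q.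
Proof. by elim: p x => [|y p IH] x /=; rewrite ?add0r // IH addrA. Qed.

Lemma nuniq_decomp p :
  ~~ uniq p -> exists y p1 p2 p3, p = p1 ++ y :: p2 ++ y :: p3.
Proof.
elim: p => //= a p IH; rewrite negb_and negbK => /orP[|/IH].
  by case/splitPr => p1 p2; exists a, [::], p1, p2.
by move=> [y [p1 [p2 [p3 ->]]]]; exists y, (a :: p1), p2, p3.
Qed.

(** A walk that visits a vertex twice splits there into a closed walk and a
    shorter walk with the same ends; weights being additive, inequalities
    between weights only have to be checked on short walks. *)
Lemma walk_split_loop e w x p : path e x p -> ~~ uniq p ->
  exists y q r, [/\ path e y q /\ last y q = y,
    path e x r /\ last x r = last x p, (size q < size p)%N, (size r < size p)%N
    & walk_weight w x p = walk_weight w y q + walk_weight w x r].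
Proof.
move=> + /nuniq_decomp[y [p1 [p2 [p3 pE]]]].
have {p pE}-> : p = rcons p1 y ++ rcons p2 y ++ p3.
  by rewrite pE -!cats1 /= -!catA.
rewrite !cat_path !last_cat !last_rcons => /andP[e1 /andP[e2 e3]].
exists y, (rcons p2 y), (rcons p1 y ++ p3).
rewrite !last_cat !last_rcons cat_path last_rcons e1 e3 !size_cat !size_rcons.
split => //; [lia | lia |].
by rewrite !walk_weight_cat !last_rcons addrCA.
Qed.

(** At a repeated vertex a closed walk splits into two, and one of them keeps a
    non-zero weight; a shortest one is therefore simple. *)
Lemma simple_closed_walk e w x p :
  path e x p -> last x p = x -> walk_weight w x p != 0 ->
  exists y q, [/\ path e y q, last y q = y, uniq q & walk_weight w y q != 0].
Proof.
move: {2}(size p).+1 (ltnSn (size p)) => n.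
elim: n x p => // n IH x p pn ep lp wp.
have [up|] := boolP (uniq p); first by exists x, p.
move=> /(walk_split_loop w ep)[y [q [r [[eq lq] [er lr] sq sr ws]]]].
have [wq|wq] := eqVneq (walk_weight w y q) 0.
  apply: (IH x r) => //; [lia | by rewrite lr |].
  by move: wp; rewrite ws wq add0r.
by apply: (IH y q) => //; lia.
Qed.

End Walks.

Lemma walk_weight_additive (T : eqType) (V W : zmodType) (f : V -> W)
    (w : T -> T -> V) x p :
  (forall a b, f (a + b) = f a + f b) -> f 0 = 0 ->
  walk_weight (fun y z => f (w y z)) x p = f (walk_weight w x p).
Proof. by move=> fD f0; elim: p x => [|y p IH] x //=; rewrite IH fD. Qed.

Lemma walk_weight_const (T : eqType) (V : zmodType) (a : V) (x : T) p :
  walk_weight (fun _ _ => a) x p = a *+ size p.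
Proof. by elim: p x => [|y p IH] x //=; rewrite IH mulrS. Qed.

Lemma walk_weightD (T : eqType) (V : zmodType) (w w' : T -> T -> V) x p :
  walk_weight (fun y z => w y z + w' y z) x p =
  walk_weight w x p + walk_weight w' x p.
Proof. by elim: p x => [|y p IH] x /=; rewrite ?addr0 // IH addrACA. Qed.

(** The weights of all walks are bounded below, as deleting closed walks does
    not increase the weight and leaves a walk of bounded length.  The least
    weight of a walk that ends in a given vertex is then a potential. *)
Lemma potential (T : finType) (e : rel T) (w : T -> T -> int) :
  (forall x p, path e x p -> last x p = x -> 0 <= walk_weight w x p) ->
  exists n : T -> int, forall x y, e x y -> n y <= n x + w x y.
Proof.
move=> loop_ge0.
have [b w_ge] : exists b : nat, forall x y, - b%:Z <= w x y.
  exists (\max_(xy : T * T) `|w xy.1 xy.2|)%N => x y.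
  suff: (`|w x y| <= \max_(xy : T * T) `|w xy.1 xy.2|)%N by lia.
  exact: (@leq_bigmax _ (fun xy => `|w xy.1 xy.2|%N) (x, y)).
have short_ge x p : - ((b * size p)%N%:Z) <= walk_weight w x p.
  elim: p x => [|y p IH] x /=; first by rewrite oppr_le0.
  by rewrite mulnS PoszD opprD lerD.
have walk_ge x p : path e x p -> - ((b * #|T|)%N%:Z) <= walk_weight w x p.
  move: {2}(size p).+1 (ltnSn (size p)) => m.
  elim: m x p => // m IH x p pm ep.
  have [up|] := boolP (uniq p).
    apply: le_trans (short_ge x p); rewrite lerN2 lez_nat leq_mul //.
    by rewrite -(card_uniqP up) max_card.
  move=> /(walk_split_loop w ep)[y [q [r [[eq lq] [er _] sq sr ->]]]].
  rewrite -[leLHS]add0r lerD ?(loop_ge0 _ _ eq lq) //.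
  exact: IH (leq_trans sr pm) er.
(* The weights are moved up by [B], so that the least one is a least natural
   number. *)
pose B := (b * #|T|)%N.
pose P y (m : nat) := `[< exists x p, [/\ path e x p, last x p = y &
  walk_weight w x p = m%:Z - B%:Z] >].
have exP y : exists m, P y m.
  by exists B; apply/asboolP; exists y, [::]; split => //=; lia.
exists (fun y => (ex_minn (exP y))%:Z - B%:Z) => x y exy.
case: ex_minnP => m _ m_min; case: ex_minnP => k /asboolP[z [p [ep lp wp]]] _.
have wpy : walk_weight w z (rcons p y) = k%:Z - B%:Z + w x y.
  by rewrite -cats1 walk_weight_cat lp /= wp addr0.
have epy : path e z (rcons p y) by rewrite rcons_path ep lp.
have := walk_ge _ _ epy; rewrite wpy -/B => ge0.
suff : (m <= `|(k%:Z + w x y)%R|)%N by lia.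
apply: m_min; apply/asboolP; exists z, (rcons p y).
by rewrite epy last_rcons wpy; split => //; lia.
Qed.

(** Every arc being traversed in both directions, two opposite inequalities
    hold: weights without closed walks of non-zero weight are differences. *)
Lemma potential_eq (T : finType) (e : rel T) (w : T -> T -> int) :
  symmetric e -> (forall x y, e x y -> w y x = - w x y) ->
  (forall x p, path e x p -> last x p = x -> walk_weight w x p = 0) ->
  exists n : T -> int, forall x y, e x y -> w x y = n y - n x.
Proof.
move=> esym wN loop0.
have [|n nP] := @potential _ e w; first by move=> x p ep lp; rewrite loop0.
exists n => x y exy; have := nP _ _ exy.
by have := nP y x; rewrite esym wN // => /(_ exy); lia.
Qed.

(** * Splitting a graph into a given cover *)

Definition sgraph_mono (G H : sgraph) (f : G -> H) : Prop :=
  injective f /\ forall x y, adj x y -> adj (f x) (f y).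

(** Splitting the vertices one after the other and joining the copies of a
    vertex as the points of its fibre are joined turns [G] into [H]; a vertex
    that is not split yet stands for its whole fibre. *)
Lemma splits_cover (k : nat) (G : sgraph) (A : {set G}) (H : sgraph)
    (prj : H -> G) :
  (forall h h', adj h h' -> adj (prj h) (prj h')) ->
  (forall x y, adj x y -> exists h h', [/\ prj h = x, prj h' = y & adj h h']) ->
  (forall x, x \in A -> (#|[set h | prj h == x]%SET| <= k)%N) ->
  (forall x, x \notin A -> exists h, [set h | prj h == x]%SET = [set h]%SET) ->
  exists (H' : sgraph) (f : H' -> H), splits k A H' /\ sgraph_mono f.
Proof.
move: {2}#|A|.+1 (ltnSn #|A|) => n.
elim: n G A prj => // n IH G A prj An hom cov fib2 fib1.
have [A0|[v vA]] := set_0Vmem A.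
  have {}fib1 x : {h | prj h = x /\ forall h', prj h' = x -> h' = h}.
    apply: cid; have [|h /setP hP] := fib1 x; first by rewrite A0 inE.
    exists h; split; first by have := hP h; rewrite !inE eqxx => /eqP.
    by move=> h' xh'; have := hP h'; rewrite !inE xh' eqxx => /esym/eqP.
  exists G, (fun x => sval (fib1 x)); split; first exact: splits_refl.
  split=> [x y xy|x y /cov[h [h' [xh yh' hh']]]].
    have [xP _] := svalP (fib1 x); have [yP _] := svalP (fib1 y).
    by rewrite -xP -yP xy.
  have [_ /(_ _ xh) <-] := svalP (fib1 x).
  by have [_ /(_ _ yh') <-] := svalP (fib1 y).
(* The copies of [v] are numbered as the points of its fibre.  Copy [i] is
   joined to [w] if some point of the fibre of [w], which may still have to be
   split itself, is adjacent to point [i]. *)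
pose F := [set h | prj h == v]%SET; pose m := #|F|.
pose a (i : 'I_m) (w : G) := [exists h', (prj h' == w) && adj (enum_val i) h'].
have Fval (i : 'I_m) : prj (enum_val i) = v.
  by have := enum_valP i; rewrite inE => /eqP.
pose G1 := split_graph v a.
have H_F h : prj h = v -> h \in F by rewrite inE => ->.
have fibre h : {i : 'I_m | prj h = v /\ enum_val i = h} + {prj h != v}.
  have [hv|] := eqVneq (prj h) v; last by right.
  left; exists (enum_rank_in (H_F h hv) h).
  by rewrite enum_rankK_in // H_F.
pose prj1 (h : H) : G1 := match fibre h with
  | inleft s => inr (sval s) | inright ne => inl (Sub (prj h) ne) end.
have prj1v h : prj h = v -> exists i, prj1 h = inr i /\ enum_val i = h.
  move=> hv; rewrite /prj1; case: (fibre h) => [[i [iv iP]]|ne];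
    first by exists i.
  by case/negP: (ne); apply/eqP.
have prj1w h : prj h != v -> exists u, prj1 h = inl u /\ val u = prj h.
  move=> hv; rewrite /prj1; case: (fibre h) => [[i [iv iP]]|ne].
    by rewrite iv eqxx in hv.
  by exists (Sub (prj h) ne).
have prj1_inl h u : prj1 h = inl u -> prj h = val u.
  have [/prj1v[i [-> _]]//|/prj1w[u' [-> <-]] [<-//]] := eqVneq (prj h) v.
have prj1_inr h i : prj1 h = inr i -> h = enum_val i.
  have [/prj1v[i' [-> <-]] [->]//|/prj1w[u' [-> _]]//] := eqVneq (prj h) v.
have inl_prj1 h u : prj h = val u -> prj1 h = inl u.
  move=> hu; have [|u' [-> u'P]] := @prj1w h; first by rewrite hu;
    exact: (valP u).
  by congr inl; apply/val_inj; rewrite u'P.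
have inr_prj1 i : prj1 (enum_val i) = inr i.
  by have [i' [-> /enum_val_inj ->]] := prj1v _ (Fval i).
have [|||||H' [f [spl mono]]] := IH G1 (split_keep v a A) prj1.
- pose g (x : G1) := if x is inl u then val u else v.
  have gP x y : x \in split_keep v a A -> y \in split_keep v a A ->
      g x = g y -> x = y.
    by case: x y => [u|i] [u'|j]; rewrite !inE //= => _ _ /val_inj ->.
  rewrite -(card_in_imset gP) -ltnS; apply: leq_trans An.
  rewrite ltnS (cardsD1 v A) vA ltnS; apply: subset_leq_card.
  apply/fintype.subsetP => _ /imsetP[[u|i] + ->]; rewrite !inE //= => ->.
  by rewrite andbT (valP u).
- move=> h h' hh'.
  have [hv|hv] := eqVneq (prj h) v; have [hv'|hv'] := eqVneq (prj h') v.
  + by have := hom _ _ hh'; rewrite hv hv' adj_irr.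
  + have [i [-> iP]] := prj1v _ hv; have [u [-> uP]] := prj1w _ hv'.
    rewrite /= uP -hv hom //=; apply/existsP; exists h'.
    by rewrite eqxx iP.
  + have [i [-> iP]] := prj1v _ hv'; have [u [-> uP]] := prj1w _ hv.
    rewrite /= uP -hv' adj_sym hom //=; apply/existsP; exists h.
    by rewrite eqxx iP adj_sym.
  + have [u [-> uP]] := prj1w _ hv; have [u' [-> uP']] := prj1w _ hv'.
    by rewrite /= uP uP' hom.
- move=> [u|i] [u'|j] //=.
  + move=> /cov[h [h' [/inl_prj1 ? /inl_prj1 ? ?]]]; by exists h, h'.
  + move=> /andP[_ /existsP[h /andP[/eqP /inl_prj1 hu jh]]].
    by exists h, (enum_val j); rewrite inr_prj1 adj_sym.
  + move=> /andP[_ /existsP[h /andP[/eqP /inl_prj1 hu ih]]].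
    by exists (enum_val i), h; rewrite inr_prj1.
- move=> [u|i]; rewrite inE //= => /fib2; apply: leq_trans.
  by apply/subset_leq_card/fintype.subsetP => h;
    rewrite !inE => /eqP/prj1_inl ->.
- move=> [u|i]; rewrite inE /=.
    move=> /fib1[h /setP hP]; exists h; apply/setP => h'.
    rewrite -hP !inE; apply/eqP/eqP => [/prj1_inl //|/inl_prj1 //].
  move=> _; exists (enum_val i); apply/setP => h; rewrite !inE.
  by apply/eqP/eqP => [/prj1_inr //|->].
exists H', f; split => //.
apply: splits_step spl => //; first exact: fib2.
move=> w /cov[h [h' [hv hw hh']]].
have [i [_ iP]] := prj1v _ hv.
by exists i; apply/existsP; exists h'; rewrite hw eqxx iP.
Qed.

(** * Drawings *)

Definition drawing (R : realType) (X : topologicalType) (G : sgraph)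
    (p : G -> X) (c : G -> G -> R -> X) : Prop :=
  [/\ injective p,
      forall x y, adj x y ->
        [/\ {within `[0, 1], continuous (c x y)},
            {in `[0, 1] &, injective (c x y)},
            c x y 0 = p x, c x y 1 = p y &
            {in `[0, 1], forall t, c y x t = c x y (1 - t)}],
      forall x y z, adj x y -> {in `]0, 1[, forall t, c x y t <> p z} &
      forall x y x' y', adj x y -> adj x' y' ->
        {in `]0, 1[ &, forall s t, c x y s = c x' y' t ->
          (x' = x /\ y' = y) \/ (x' = y /\ y' = x)}].

Lemma embeddable_mono (R : realType) (X : topologicalType) (G H : sgraph)
    (f : G -> H) :
  sgraph_mono f -> embeddable R X H -> embeddable R X G.
Proof.
move=> [finj fadj] [p [c [pinj arc vert cross]]].
exists (p \o f), (fun x y => c (f x) (f y)); split => /=.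
- by move=> x y /pinj/finj.
- by move=> x y /fadj; exact: arc.
- by move=> x y z /fadj; exact: vert.
- move=> x y x' y' /fadj xy /fadj xy' s t sI tI /(cross _ _ _ _ xy xy' _ _ sI
    tI).
  by case=> -[/finj -> /finj ->]; [left|right].
Qed.

Lemma in_cc1B (R : realType) (t : R) : t \in `[0, 1] -> 1 - t \in `[0, 1].
Proof. by rewrite !in_itv /= => /andP[t0 t1]; apply/andP; split; lra. Qed.

Lemma in_oo1B (R : realType) (t : R) : t \in `]0, 1[ -> 1 - t \in `]0, 1[.
Proof. by rewrite !in_itv /= => /andP[t0 t1]; apply/andP; split; lra. Qed.

Lemma in_oo_cc (R : realType) (t : R) : t \in `]0, 1[ -> t \in `[0, 1].
Proof. by rewrite !in_itv /= => /andP[t0 t1]; apply/andP; split; lra. Qed.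

Lemma in_cc0 (R : realType) : (0 : R) \in `[0, 1].
Proof. by rewrite in_itv /= lexx ler01. Qed.

Lemma in_cc1 (R : realType) : (1 : R) \in `[0, 1].
Proof. by rewrite in_itv /= lexx ler01. Qed.

(** The arcs of an edge in its two directions determine each other, so that a
    choice only has to be made in the direction fixed here. *)
Definition ordered (G : sgraph) (x y : G) : bool :=
  (enum_rank x < enum_rank y)%N.

Lemma orderedN (G : sgraph) (x y : G) :
  adj x y -> ordered x y = false -> ordered y x.
Proof.
move=> xy; rewrite /ordered; case: ltngtP => // /ord_inj/enum_rank_inj xyE.
by rewrite xyE adj_irr in xy.
Qed.

Lemma ordered_asym (G : sgraph) (x y : G) : ordered x y -> ordered y x = false.
Proof. by rewrite /ordered; case: ltngtP. Qed.

(** A cover of a drawn graph inherits a drawing as soon as the arcs are lifted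
    consistently.  The relation [rho] is the graph of a map from a part of [X]
    to [Y]: points over distinct points are distinct, and so only two lifts of
    one arc may still meet. *)
Lemma embeddable_lift (R : realType) (X Y : topologicalType) (G H : sgraph)
    (p : G -> Y) (c : G -> G -> R -> Y) (prj : H -> G) (rho : X -> Y -> Prop)
    (P : H -> X) (E : H -> H -> R -> X) :
  drawing p c ->
  (forall h h', adj h h' -> adj (prj h) (prj h')) ->
  (forall x y y', rho x y -> rho x y' -> y = y') ->
  injective P -> (forall h, rho (P h) (p (prj h))) ->
  (forall h h', adj h h' -> ordered (prj h) (prj h') ->
    [/\ continuous (E h h'), E h h' 0 = P h, E h h' 1 = P h' &
        {in `[0, 1], forall t, rho (E h h' t) (c (prj h) (prj h') t)}]) ->
  (forall h h' k k', adj h h' -> adj k k' -> ordered (prj h) (prj h') ->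
    prj h = prj k -> prj h' = prj k' ->
    {in `]0, 1[, forall t, E h h' t = E k k' t -> h = k /\ h' = k'}) ->
  embeddable R X H.
Proof.
move=> [pinj arc vert cross] hom rhoF Pinj rhoP EP Ecoh.
pose C h h' t := if ordered (prj h) (prj h') then E h h' t else E h' h (1 - t).
have Cord h h' : adj h h' -> exists k k' (r : R -> R),
    [/\ adj k k', ordered (prj k) (prj k'),
        {in `[0, 1], forall t, r t \in `[0, 1]},
        {in `]0, 1[, forall t, r t \in `]0, 1[} &
        (forall t, C h h' t = E k k' (r t)) /\
        ((k = h /\ k' = h' /\ forall t, r t = t) \/
         (k = h' /\ k' = h /\ forall t, r t = 1 - t))].
  move=> hh'; have [ord|no] := boolP (ordered (prj h) (prj h')).
    exists h, h', id; split => //; split; last by left.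
    by move=> t; rewrite /C ord.
  have o := orderedN (hom _ _ hh') (negbTE no).
  exists h', h, (fun t => 1 - t); split => //; first by rewrite adj_sym.
  - by move=> t; exact: in_cc1B.
  - by move=> t; exact: in_oo1B.
  - by split; [move=> t; rewrite /C (negbTE no) | right].
have Einj h h' : adj h h' -> ordered (prj h) (prj h') ->
    {in `[0, 1] &, injective (E h h')}.
  move=> hh' o s t sI tI Est; have [_ _ _ Erho] := EP _ _ hh' o.
  have [_ cinj _ _ _] := arc _ _ (hom _ _ hh').
  by apply: cinj => //; apply: rhoF (Erho _ sI) _; rewrite Est; exact: Erho.
exists P, C; split=> [//|h h' hh'|h h' z hh' t tI|h h' l l' hh' ll' s t sI tI].
- have [k [k' [r [kk' o rI _ [CE khr]]]]] := Cord _ _ hh'.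
  have [Ec E0 E1 _] := EP _ _ kk' o.
  have -> : C h h' = E k k' \o r by apply/funext => t; exact: CE.
  have rP : r = id \/ r = (fun t => 1 - t).
    by case: khr => -[_ [_ rE]]; [left|right]; apply/funext.
  split.
  + apply: continuous_subspaceT => t; apply: continuous_comp; last exact: Ec.
    case: rP => ->; first exact: cvg_id.
    by apply: cvgB; [exact: cvg_cst | exact: cvg_id].
  + move=> s t sI tI /=; case: rP => rE; rewrite rE.
      exact: Einj kk' o _ _ sI tI.
    move=> /Einj EE; have {}EE := EE kk' o (in_cc1B sI) (in_cc1B tI); lra.
  + by case: khr => -[? [? rE]]; subst; rewrite /= rE ?subr0.
  + by case: khr => -[? [? rE]]; subst; rewrite /= rE ?subrr.
  + move=> t tI /=.
    case: khr => -[kh [k'h rE]]; move: o; rewrite rE kh k'h => o.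
      by rewrite /C (ordered_asym o).
    by rewrite /C o subKr.
- have [k [k' [r [kk' o _ rI [-> _]]]]] := Cord _ _ hh'.
  have [_ _ _ Erho] := EP _ _ kk' o => Ez.
  apply: (vert _ _ (prj z) (hom _ _ kk') (r t) (rI _ tI)).
  by apply: rhoF (Erho _ (in_oo_cc (rI _ tI))) _; rewrite Ez.
- have [k [k' [r [kk' o _ rI [-> kh]]]]] := Cord _ _ hh'.
  have [m [m' [q [mm' o' _ qI [-> ml]]]]] := Cord _ _ ll'.
  move=> Eeq; have rt := rI _ sI; have qt := qI _ tI.
  have [_ _ _ Erho] := EP _ _ kk' o; have [_ _ _ Erho'] := EP _ _ mm' o'.
  have ceq : c (prj k) (prj k') (r s) = c (prj m) (prj m') (q t).
    by apply: rhoF (Erho _ (in_oo_cc rt)) _; rewrite Eeq; exact/Erho'/in_oo_cc.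
  have [kE k'E] : prj m = prj k /\ prj m' = prj k'.
    have [//|[mk mk']] := cross _ _ _ _ (hom _ _ kk') (hom _ _ mm')
      _ _ rt qt ceq.
    by move: o'; rewrite mk mk' ordered_asym.
  have [_ cinj _ _ _] := arc _ _ (hom _ _ kk').
  have rq : r s = q t.
    by apply: cinj; rewrite ?in_oo_cc // ceq kE k'E.
  rewrite -rq in Eeq.
  have [km km'] := Ecoh _ _ _ _ kk' mm' o (esym kE) (esym k'E) _ rt Eeq.
  case: kh => -[? [? _]]; case: ml => -[? [? _]]; subst;
    by [left | right].
Qed.

Lemma embeddable_edgeless (R : realType) (G : sgraph) :
  (forall x y : G, ~~ adj x y) -> planar R G.
Proof.
move=> noedge.
exists (fun x => const_mx (enum_rank x)%:R), (fun _ _ _ => 0); split.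
- move=> x y /matrixP/(_ ord0 ord0); rewrite !mxE => /eqP.
  by rewrite eqr_nat => /eqP/ord_inj/enum_rank_inj.
- by move=> x y xy; have := noedge x y; rewrite xy.
- by move=> x y z xy; have := noedge x y; rewrite xy.
- by move=> x y x' y' xy; have := noedge x y; rewrite xy.
Qed.

Lemma splittable_planar (R : realType) (k : nat) (G : sgraph) :
  planar R G -> splittable R k G.
Proof. by move=> Gpl; exists G; split => //; exact: splits_refl. Qed.

Lemma splittable_cover (R : realType) (k : nat) (G H : sgraph) (prj : H -> G) :
  (forall h h', adj h h' -> adj (prj h) (prj h')) ->
  (forall x y, adj x y -> exists h h', [/\ prj h = x, prj h' = y & adj h h']) ->
  (forall x, (#|[set h | prj h == x]%SET| <= k)%N) ->
  planar R H -> splittable R k G.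
Proof.
move=> hom cov fib Hpl.
have [|x|H' [f [spl mono]]] := splits_cover (k := k) (A := [set: G]%SET)
  hom cov.
- by move=> x _.
- by rewrite inE.
by exists H'; split => //; exact: embeddable_mono mono Hpl.
Qed.

Definition point2 (R : realType) (a b : R) : 'rV[R]_2 :=
  \row_j (if j == ord0 then a else b).

Lemma point2_inj (R : realType) (a b a' b' : R) :
  point2 a b = point2 a' b' -> a = a' /\ b = b'.
Proof.
move=> /rowP ab; have := ab ord0; have := ab (lift ord0 ord0).
by rewrite !mxE /= => -> ->.
Qed.

Lemma continuous_point2 (R : realType) (T : topologicalType) (f g : T -> R) :
  continuous f -> continuous g -> continuous (fun t => point2 (f t) (g t) :
    plane R).
Proof.
move=> fc gc t A [P nP PA]; rewrite /= nbhs_simpl /=.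
have near_coord i j : \forall u \near t, P i j (point2 (f u) (g u) i j).
  have := nP i j; rewrite !mxE; case: ifP => j0 nPij.
    have : \forall u \near t, P i j (f u) by exact: fc.
    by apply: filterS => u; rewrite mxE j0.
  have : \forall u \near t, P i j (g u) by exact: gc.
  by apply: filterS => u; rewrite mxE j0.
have : \forall u \near t, forall i j, P i j (point2 (f u) (g u) i j).
  by apply: filter_forall => i; apply: filter_forall => j; exact: near_coord.
by apply: filterS => u Pu; apply: PA.
Qed.

(** * Crossing paths in a rectangle *)

(** The edges of the grid at whose ends [a] is false and along which [b] changes
    are crossed by a curve that leaves a unit square it enters unless both signs
    change at the corners of the square.  Along the boundary of the grid the
    number of such edges is odd: they all lie on the right side, where [b]
    changes from true to false. *)
Lemma grid_sign_change (a b : nat -> nat -> bool) (n m : nat) :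
  (forall j, (j <= m)%N -> a 0%N j) -> (forall j, (j <= m)%N -> ~~ a n j) ->
  (forall i, (i <= n)%N -> b i 0%N) -> (forall i, (i <= n)%N -> ~~ b i m) ->
  exists i j, [/\ (i < n)%N, (j < m)%N &
    [&& [exists d : bool * bool, a (i + d.1)%N (j + d.2)%N],
        [exists d : bool * bool, ~~ a (i + d.1)%N (j + d.2)%N],
        [exists d : bool * bool, b (i + d.1)%N (j + d.2)%N] &
        [exists d : bool * bool, ~~ b (i + d.1)%N (j + d.2)%N]]].
Proof.
move=> left right bot top; apply: contrapT => nosq.
(* [V i m] is the parity of the number of such edges in column [i]. *)
pose cross i j i' j' := [&& ~~ a i j, ~~ a i' j' & b i j (+) b i' j'].
pose V i k := \big[addb/false]_(j < k) cross i j i j.+1.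
have square i j : (i < n)%N -> (j < m)%N ->
    cross i j i.+1 j (+) cross i j.+1 i.+1 j.+1 (+)
    cross i j i j.+1 (+) cross i.+1 j i.+1 j.+1 = false.
  move=> lin ljm.
  pose corner (Q : rel nat) := Q i j || Q i.+1 j || Q i j.+1 || Q i.+1 j.+1.
  have cornerP (Q : rel nat) : corner Q ->
      [exists d : bool * bool, Q (i + d.1)%N (j + d.2)%N].
    move=> QP; apply/existsP; case/orP: QP => [/orP[/orP[QP|QP]|QP]|QP].
    - by exists (false, false); rewrite !addn0.
    - by exists (true, false); rewrite addn0 addn1.
    - by exists (false, true); rewrite addn0 addn1.
    - by exists (true, true); rewrite !addn1.
  apply/negbTE/negP => odd_cross; apply: nosq; exists i, j; split => //.
  have : [&& corner a, corner (fun i j => ~~ a i j), corner b &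
             corner (fun i j => ~~ b i j)].
    move: odd_cross; rewrite /cross /corner.
    case: (a i j) (a i.+1 j) (a i j.+1) (a i.+1 j.+1) => [] [] [] [] //=;
    by case: (b i j) (b i.+1 j) (b i j.+1) (b i.+1 j.+1) => [] [] [] [].
  by case/and4P=> /cornerP ? /cornerP ? /cornerP ? /cornerP ?; exact/and4P.
have strip i k : (i < n)%N -> (k <= m)%N ->
    V i k (+) V i.+1 k = cross i 0%N i.+1 0%N (+) cross i k i.+1 k.
  move=> lin; elim: k => [|k IH] km; first by rewrite /V !big_ord0 !addbb.
  have := square i k lin km; have := IH (ltnW km); rewrite /V !big_ord_recr /=.
  move: (\big[_/_]_(_ < _) _) (\big[_/_]_(_ < _) _).
  move: (cross _ _ _ _) (cross _ _ _ _) (cross _ _ _ _) (cross _ _ _ _)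
    (cross _ _ _ _).
  by do 7! case.
have V0 i : (i <= n)%N -> V i m = false.
  elim: i => [_|i IH lin].
    by rewrite /V big1 // => j _; rewrite /cross left // ltnW.
  have := strip i m lin (leqnn m); rewrite IH ?(ltnW lin) // /cross.
  by rewrite !bot ?(negbTE (top _ _)) ?(ltnW lin) // !andbF.
have Vn k : (k <= m)%N -> V n k = ~~ b n k.
  elim: k => [_|k IH km]; first by rewrite /V big_ord0 bot.
  rewrite /V big_ord_recr /= -/(V n k) IH ?(ltnW km)
    // /cross !right ?(ltnW km) //=.
  by case: (b n k) (b n k.+1) => [] [].
by have := Vn m (leqnn m); rewrite V0 // top.
Qed.

Lemma uniformly_continuous_segment (R : realType) (f : R -> R) (a b e : R) :
  continuous f -> 0 < e -> exists2 d, 0 < d &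
  forall s t, s \in `[a, b] -> `|s - t| < d -> `|f s - f t| < e.
Proof.
move=> fc e0.
have cover := (compact_near_coveringP _).1 (@segment_compact R a b).
have : \forall d \near (0 : R)^'+, `[a, b]%classic `<=`
    (fun s => forall t, `|s - t| < d -> `|f s - f t| < e).
  apply: cover => x _.
  have e20 : 0 < e / 2 by lra.
  have /cvgrPdist_lt/(_ _ e20)/nbhs_ballP[d /= d0 dP] := fc x.
  exists (ball x (d / 2), [set i | i < d / 2]) => /=.
    split; first by apply: nbhsx_ballx; lra.
    by apply: nbhs_right_lt; lra.
  move=> [x' i] /= [xx' id2] t x't; rewrite /ball /= in xx'.
  have h1 : `|f x - f x'| < e / 2 by apply: dP; rewrite /ball /=; lra.
  have h2 : `|f x - f t| < e / 2.
    apply: dP; rewrite /ball /=; rewrite [x - t](_ : _ = (x - x') + (x' - t));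
      last by ring.
    by apply: le_lt_trans (ler_normD _ _) _; lra.
  rewrite [f x' - f t](_ : _ = (f x - f t) - (f x - f x')); last by ring.
  by apply: le_lt_trans (ler_normB _ _) _; lra.
move=> dP; near (0 : R)^'+ => d.
exists d => [|s t sI]; first by near: d; exact: nbhs_right_gt.
suff /(_ s) : `[a, b]%classic `<=`
    (fun s => forall t, `|s - t| < d -> `|f s - f t| < e) by apply.
by near: d.
Unshelve. all: by end_near.
Qed.

Lemma grid_step (R : realType) (T d : R) :
  0 < T -> 0 < d -> exists n : nat,
    [/\ (0 < n)%N, (n%:R * (T / n%:R) =
      T) & forall m, (n <= m)%N -> T / m%:R < d].
Proof.
move=> T0 d0; pose n := (Num.truncn (T / d)).+1.
have n0 : (0 : R) < n%:R by rewrite ltr0n.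
exists n; split => //; first by field; rewrite gt_eqF.
move=> m nm; have m0 : (0 : R) < m%:R by rewrite ltr0n (leq_trans _ nm).
rewrite ltr_pdivrMr // mulrC -ltr_pdivrMr //.
apply: lt_le_trans (truncnS_gt _) _; by rewrite ler_nat.
Qed.

(** A path from the left to the right side of a rectangle meets a path from its
    bottom to its top: were their distance positive, the signs of the two
    coordinates of their difference on a fine grid would contradict
    [grid_sign_change]. *)
Lemma paths_meet (R : realType) (a1 a2 b1 b2 : R -> R) (S T : R) :
  continuous a1 -> continuous a2 -> continuous b1 -> continuous b2 ->
  0 < S -> 0 < T ->
  {in `[0, T], forall t, a1 0 < b1 t < a1 S} ->
  {in `[0, S], forall s, b2 0 < a2 s < b2 T} ->
  exists s t, [/\ s \in `[0, S], t \in `[0, T], a1 s = b1 t & a2 s = b2 t].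
Proof.
move=> a1c a2c b1c b2c S0 T0 horiz vertic; apply: contrapT => nomeet.
pose g (z : R * R) : R := `|a1 z.1 - b1 z.2| + `|a2 z.1 - b2 z.2|.
have gc : continuous g.
  have fstc (f : R -> R) : continuous f -> continuous (fun z : R * R => f z.1).
    by move=> fc z; apply: continuous_comp; [exact: cvg_fst | exact: fc].
  have sndc (f : R -> R) : continuous f -> continuous (fun z : R * R => f z.2).
    by move=> fc z; apply: continuous_comp; [exact: cvg_snd | exact: fc].
  move=> z; apply: cvgD; apply: cvg_norm; apply: cvgB;
    by [exact: fstc | exact: sndc].
have K0 : (`[0, S]%classic `*` `[0, T]%classic) !=set0.
  by exists (0, 0); split; rewrite /= in_itv /= lexx ltW.
have Kc : compact (`[0, S]%classic `*` `[0, T]%classic : set (R * R)).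
  by apply: compact_setX; exact: segment_compact.
have [[s0 t0] /set_mem[/= s0I t0I] gmin] :=
  compact_EVT_min K0 Kc (continuous_subspaceT gc).
pose e := g (s0, t0).
have e0 : 0 < e.
  rewrite lt_neqAle /e /g addr_ge0 ?andbT //=; apply/negP => /eqP/esym/eqP.
  rewrite paddr_eq0 // !normr_eq0 !subr_eq0 => /andP[/eqP h1 /eqP h2].
  by apply: nomeet; exists s0, t0; split.
(* If both signs change at the corners of a small square, then each of the two
   differences is less than [e / 2] at each corner: it differs by less than that
   from its values at the other corners, which take both signs. *)
have e40 : 0 < e / 4 by lra.
have [d1 d10 a1u] := uniformly_continuous_segment 0 S a1c e40.
have [d2 d20 a2u] := uniformly_continuous_segment 0 S a2c e40.
have [d3 d30 b1u] := uniformly_continuous_segment 0 T b1c e40.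
have [d4 d40 b2u] := uniformly_continuous_segment 0 T b2c e40.
pose d := Num.min (Num.min d1 d2) (Num.min d3 d4).
have d0 : 0 < d by rewrite !lt_min d10 d20 d30 d40.
have [n1 [n10 _ n1P]] := grid_step S0 d0;
  have [n2 [_ _ n2P]] := grid_step T0 d0.
pose n := maxn n1 n2.
have nR0 : (0 : R) < n%:R by rewrite ltr0n (leq_trans n10 (leq_maxl _ _)).
have Sd : S / n%:R < d by apply: n1P; exact: leq_maxl.
have Td : T / n%:R < d by apply: n2P; exact: leq_maxr.
pose s (i : nat) := i%:R * (S / n%:R); pose t (i : nat) := i%:R * (T / n%:R).
have sn : s n = S by rewrite /s; field; rewrite gt_eqF.
have tn : t n = T by rewrite /t; field; rewrite gt_eqF.
have sI i : (i <= n)%N -> s i \in `[0, S].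
  move=> lin; have D0 : 0 <= S / n%:R by rewrite divr_ge0 // ltW.
  rewrite in_itv /= mulr_ge0 ?ler0n //= -sn ler_wpM2r ?ler_nat //.
have tI i : (i <= n)%N -> t i \in `[0, T].
  move=> lin; have D0 : 0 <= T / n%:R by rewrite divr_ge0 // ltW.
  rewrite in_itv /= mulr_ge0 ?ler0n //= -tn ler_wpM2r ?ler_nat //.
have [||||i [j [lin ljn]]] := @grid_sign_change
    (fun i j => a1 (s i) < b1 (t j)) (fun i j => b2 (t j) < a2 (s i)) n n.
- by move=> j jn; rewrite /s mul0r; have /andP[] := horiz _ (tI _ jn).
- by move=> j jn; rewrite sn -leNgt ltW //; have /andP[] := horiz _ (tI _ jn).
- by move=> i lin; rewrite /t mul0r; have /andP[] := vertic _ (sI _ lin).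
- by move=> i lin; rewrite tn -leNgt ltW //;
    have /andP[] := vertic _ (sI _ lin).
have near_corner (c : bool * bool) :
    [/\ `|a1 (s i) - a1 (s (i + c.1)%N)| < e / 4,
        `|a2 (s i) - a2 (s (i + c.1)%N)| < e / 4,
        `|b1 (t j) - b1 (t (j + c.2)%N)| < e / 4 &
        `|b2 (t j) - b2 (t (j + c.2)%N)| < e / 4].
  have h (b : bool) (D : R) : 0 < D -> D < d -> b%:R * D < d.
    by case: b => D0 Dd; rewrite ?mul1r ?mul0r.
  have sd : `|s i - s (i + c.1)%N| < d.
    rewrite /s natrD mulrDl opprD addrA subrr sub0r normrN ger0_norm.
      by apply: h => //; exact: divr_gt0.
    by rewrite mulr_ge0 ?divr_ge0 // ltW.
  have td : `|t j - t (j + c.2)%N| < d.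
    rewrite /t natrD mulrDl opprD addrA subrr sub0r normrN ger0_norm.
      by apply: h => //; exact: divr_gt0.
    by rewrite mulr_ge0 ?divr_ge0 // ltW.
  have siI := sI _ (ltnW lin); have tjI := tI _ (ltnW ljn).
  move: sd td; rewrite /d !lt_min => /andP[/andP[? ?] _] /andP[_ /andP[? ?]].
  by split; [exact: a1u | exact: a2u | exact: b1u | exact: b2u].
move=> /and4P[/existsP[c1 h1] /existsP[c2 h2] /existsP[c3 h3] /existsP[c4 h4]].
have : e <= g (s i, t j).
  by apply: gmin; apply/mem_set; split; [exact/sI/ltnW | exact/tI/ltnW].
rewrite leNgt => /negP; apply; rewrite /g /=.
have [+ _ + _] := near_corner c1; have [+ _ + _] := near_corner c2.
have [_ + _ +] := near_corner c3; have [_ + _ +] := near_corner c4.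
rewrite -leNgt in h2; rewrite -leNgt in h4; move: h1 h2 h3 h4.
move: (a1 _) (a1 _) (a1 _) (b1 _) (b1 _) (b1 _) => x y z x' y' z'.
move: (a2 _) (a2 _) (a2 _) (b2 _) (b2 _) (b2 _) => u v w u' v' w'.
have E (q r : R) : (`|q - r| < e / 4) =
  (- (e / 4) < q - r < e / 4) by rewrite ltr_norml.
rewrite !E => h1 h2 h3 h4 /andP[? ?] /andP[? ?] /andP[? ?] /andP[? ?] /andP[?
  ?] /andP[? ?] /andP[? ?] /andP[? ?].
suff [hx hu] : `|x - x'| < e / 2 /\ `|u - u'| < e / 2 by lra.
by split; rewrite ltr_norml; apply/andP; split; lra.
Qed.

(** * Lifting paths *)

(** The retraction of the line onto [[0, r]], in a form that is visibly
    continuous. *)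
Definition clamp (R : realType) (r t : R) : R := (r + `|t| - `|t - r|) / 2.

Lemma continuous_clamp (R : realType) (r : R) : continuous (clamp r).
Proof.
move=> t; apply: cvgM; last exact: cvg_cst.
apply: cvgB; first by apply: cvgD; [exact: cvg_cst | exact: cvg_norm].
by apply: cvg_norm; apply: cvgB; [exact: cvg_id | exact: cvg_cst].
Qed.

Lemma clamp_in (R : realType) (r t : R) : t \in `[0, r] -> clamp r t = t.
Proof.
rewrite in_itv /= /clamp => /andP[t0 tr].
by rewrite ger0_norm // ler0_norm ?subr_le0 //; field.
Qed.

Lemma clamp_le0 (R : realType) (r t : R) : 0 <= r -> t <= 0 -> clamp r t = 0.
Proof.
by move=> r0 t0; rewrite /clamp !ler0_norm ?subr_le0 //; [field | lra].
Qed.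

Lemma clamp_ge (R : realType) (r t : R) : 0 <= r -> r <= t -> clamp r t = r.
Proof.
by move=> r0 t0; rewrite /clamp !ger0_norm ?subr_ge0 //; [field | lra].
Qed.

Lemma clamp_range (R : realType) (r t : R) : 0 <= r -> clamp r t \in `[0, r].
Proof.
move=> r0; rewrite in_itv /=; have [t0|t0] := lerP t 0.
  by rewrite clamp_le0 // lexx.
have [tr|rt] := lerP t r; last by rewrite clamp_ge ?lexx ?r0 // ltW.
by rewrite clamp_in ?in_itv /= ?tr ltW.
Qed.

Lemma clamp_clamp (R : realType) (r s t : R) : 0 <= r -> r <= s ->
  `|clamp r t - clamp s t| <= s - r.
Proof.
move=> r0 rs; have s0 : 0 <= s by lra.
have [t0|t0] := lerP t 0; first by rewrite !clamp_le0 // subrr normr0 subr_ge0.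
have [tr|rt] := lerP t r.
  by rewrite !clamp_in ?subrr ?normr0 ?subr_ge0 // in_itv /= ltW //=; lra.
rewrite (@clamp_ge _ r) //; last exact: ltW.
have [ts|st] := lerP t s; last first.
  by rewrite clamp_ge ?(ltW st) // distrC ger0_norm; lra.
rewrite clamp_in; last by rewrite in_itv /= ltW //= .
by rewrite distrC ger0_norm; lra.
Qed.

Lemma clamp0 (R : realType) (t : R) : clamp 0 t = 0.
Proof. by rewrite /clamp subr0 add0r subrr mul0r. Qed.

Lemma continuous_clamp_comp (R : realType) (X : topologicalType) (f : R -> X) :
  {within `[0, 1], continuous f} -> continuous (f \o clamp 1).
Proof.
move=> /subspace_continuousP cf x A nA;
  have xI : (`[0, 1]%classic : set R) (clamp 1 x).
  by rewrite /= clamp_range.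
have := cf _ xI A nA; rewrite /= /within /= => near_y.
have := continuous_clamp near_y; rewrite /= nbhs_simpl /=.
by apply: filterS => y; apply; rewrite /= clamp_range.
Qed.

Lemma continuous_sphere_coord (R : realType) (n : nat) (j : 'I_n.+1) :
  continuous (fun x : set_type (sphere R n) => val x ord0 j).
Proof.
move=> x; apply: (@continuous_comp _ _ _ (set_val : sphere R n -> _)
  (fun M : 'rV[R]_n.+1 => M ord0 j)).
  exact: initial_continuous.
exact: coord_continuous.
Qed.

Lemma cos2pi_int (R : realType) (k : int) : cos (2 * pi * k%:~R) = 1 :> R.
Proof.
have h (n : nat) : cos (2 * pi * n%:R) = 1 :> R.
  have := periodicn (@cosD2pi R) n 0; rewrite add0r cos0 => h; rewrite -[RHS]h.
  by congr cos; rewrite -[(pi *+ 2) *+ n]mulr_natr -[pi *+ 2]mulr_natr; ring.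
case: k => n; first exact: h.
by rewrite NegzE mulrNz mulrN cosN h.
Qed.

Lemma cos2pi_eq1 (R : realType) (x : R) :
  cos (2 * pi * x) = 1 -> exists k : int, x = k%:~R.
Proof.
move=> cx; exists (Num.floor x).
pose r := x - (Num.floor x)%:~R;
  have xE : x = r + (Num.floor x)%:~R by rewrite /r subrK.
have r0 : 0 <= r by have := floor_le x; rewrite /r; lra.
have r1 : r < 1 by have := floorD1_gt x; rewrite /r intrD; lra.
have cr : cos (2 * pi * r) = 1.
  have -> : 2 * pi * r = 2 * pi * x - 2 * pi * (Num.floor x)%:~R by rewrite /r;
    ring.
  rewrite cosB cx cos2pi_int;
    have := cos2Dsin2 (2 * pi * (Num.floor x)%:~R : R).
  rewrite cos2pi_int expr1n => /eqP; rewrite -subr_eq0 addrC addKr sqrf_eq0.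
  by move=> /eqP ->; rewrite mulr0 addr0 mulr1.
suff r_eq0 : r = 0 by rewrite {1}xE r_eq0 add0r.
apply/eqP; rewrite eq_le r0 andbT leNgt; apply/negP => rgt0.
have pi0 := pi_gt0 R.
have : 0 < sin (pi * r) by apply: sin_gt0_pi; rewrite mulr_gt0 //= gtr_pMr.
move: cr.
have -> : 2 * pi * r = (pi * r) *+ 2 by rewrite -[_ *+ 2]mulr_natr; ring.
rewrite cos_mulr2n cos2sin2 => h; have : sin (pi * r) ^+ 2 = 0 by lra.
by move=> /eqP; rewrite sqrf_eq0 => /eqP ->; rewrite ltxx.
Qed.

Lemma cos_sin_2pi_eq (R : realType) (a b : R) :
  cos (2 * pi * a) = cos (2 * pi * b) -> sin (2 * pi * a) = sin (2 * pi * b) ->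
  exists k : int, a = b + k%:~R.
Proof.
move=> cab sab; have [|k kE] := @cos2pi_eq1 R (a - b).
  by rewrite mulrBr cosB cab sab -!expr2 cos2Dsin2.
by exists k; rewrite -kE addrC subrK.
Qed.

Lemma cos_sin_2piD_int (R : realType) (a : R) (k : int) :
  cos (2 * pi * (a + k%:~R)) = cos (2 * pi * a) /\
  sin (2 * pi * (a + k%:~R)) = sin (2 * pi * a).
Proof.
have c1 := cos2pi_int R k.
have s0 : sin (2 * pi * k%:~R) = 0 :> R.
  have := cos2Dsin2 (2 * pi * k%:~R : R).
  rewrite c1 expr1n => /eqP; rewrite -subr_eq0 addrC addKr sqrf_eq0.
  by move=> /eqP.
by rewrite mulrDr cosD sinD c1 s0 !mulr0 !mulr1 subr0 addr0.
Qed.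

Lemma angleK (R : realType) (a : R) : 2 * pi * (a / (2 * pi)) = a.
Proof.
have : pi != 0 :> R by rewrite gt_eqF // pi_gt0.
by move: pi => p p0; field.
Qed.

Lemma angle_exists (R : realType) (u v : R) : u ^+ 2 + v ^+ 2 = 1 ->
  exists a, cos (2 * pi * a) = u /\ sin (2 * pi * a) = v.
Proof.
move=> uv; have pi0 := pi_gt0 R.
have uI : u \in `[-1, 1].
  rewrite in_itv /=; have : u ^+ 2 <= 1 by rewrite -uv lerDl sqr_ge0.
  by move=> u1; apply/andP; split; nra.
have cu := acosK uI; have := cos2Dsin2 (acos u); rewrite cu => uv'.
have : sin (acos u) ^+ 2 = v ^+ 2 by lra.
move=> /eqP; rewrite eqf_sqr => /orP[]/eqP sv.
  exists (acos u / (2 * pi)).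
  by rewrite angleK.
exists (- acos u / (2 * pi)).
by rewrite angleK cosN sinN cu sv opprK.
Qed.

Lemma cos_sin_atan (R : realType) (c s : R) :
  0 < c -> c ^+ 2 + s ^+ 2 = 1 -> cos (atan (s / c)) =
    c /\ sin (atan (s / c)) = s.
Proof.
move=> c0 cs; have cn0 : c != 0 by rewrite gt_eqF.
have cosE : cos (atan (s / c)) = c.
  rewrite cos_atan; have -> : 1 + (s / c) ^+ 2 = c^-1 ^+ 2.
    have -> : 1 + (s / c) ^+ 2 = (c ^+ 2 + s ^+ 2) / c ^+ 2 by field.
    by rewrite cs mul1r exprVn.
  by rewrite sqrtr_sqr ger0_norm ?invrK // invr_ge0 ltW.
split => //; have := atanK (s / c); rewrite /tan cosE => /(congr1 ( *%R^~ c)).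
by rewrite !divfK.
Qed.

(** A path in the circle or in the projective plane is lifted in steps so short
    that on each of them the lift is given by a formula in terms of where the
    previous one ended.  Each partial lift stands still after its last step, so
    it is continuous on the whole line. *)
Lemma lift_by_steps (R : realType) (A : Type) (reg : (R -> A) -> Prop)
    (over : A -> R -> Prop) (d : R) :
  0 < d -> (exists g, reg g /\ forall t, over (g t) 0) ->
  (forall g r s, 0 <= r -> r <= s -> s <= 1 -> s - r < d ->
    reg g -> (forall t, over (g t) (clamp r t)) ->
    exists g', reg g' /\ forall t, over (g' t) (clamp s t)) ->
  exists g, reg g /\ {in `[0, 1], forall t, over (g t) t}.
Proof.
move=> d0 start step.
have [n [n0 nE nd]] := grid_step (@ltr01 R) d0.
have D0 : (0 : R) <= 1 / n%:R by rewrite divr_ge0.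
have partial k : (k <= n)%N ->
    exists g, reg g /\ forall t, over (g t) (clamp (k%:R * (1 / n%:R)) t).
  elim: k => [_|k IH kn].
    by have [g [rg gP]] := start; exists g; split => // t; rewrite mul0r clamp0.
  have [g [rg gP]] := IH (ltnW kn).
  apply: (step g (k%:R * (1 / n%:R)) _ _ _ _ _ rg gP).
  - by rewrite mulr_ge0.
  - by rewrite ler_wpM2r // ler_nat.
  - by rewrite -[leRHS]nE ler_wpM2r // ler_nat.
  - by rewrite -mulrBl -natrB // subSnn mul1r; exact: nd.
have [g [rg gP]] := partial n (leqnn n).
by exists g; split => // t tI; have := gP t; rewrite nE clamp_in.
Qed.

(** The next step turns by the angle from the old point of the circle to the new
    one, an arctangent as long as their inner product is positive. *)
Lemma circle_path_lift (R : realType) (u v : R -> R) :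
  continuous u -> continuous v -> (forall t, u t ^+ 2 + v t ^+ 2 = 1) ->
  exists th : R -> R, continuous th /\
    {in `[0, 1], forall t, cos (2 * pi * th t) = u t /\ sin (2 * pi * th t) =
      v t}.
Proof.
move=> uc vc uv.
(* Points of the circle whose coordinates differ by less than [1 / 2] have an
   inner product greater than [3 / 4]. *)
have h0 : (0 : R) < 1 / 2 by lra.
have [d1 d10 ud] := uniformly_continuous_segment 0 1 uc h0.
have [d2 d20 vd] := uniformly_continuous_segment 0 1 vc h0.
apply: (@lift_by_steps R R (fun g => continuous g)
  (fun a t => cos (2 * pi * a) = u t /\ sin (2 * pi * a) = v t)
  (Num.min d1 d2)).
- by rewrite lt_min d10.
- by have [a aP] := angle_exists (uv 0); exists (fun=> a); split => // t;
    exact: cvg_cst.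
move=> g r s r0 rs s1 sr gc gP.
have uvc (w : R -> R) x : continuous w -> continuous (w \o clamp x).
  by move=> wc t; apply: continuous_comp; [exact: continuous_clamp | exact: wc].
pose U t := u (clamp r t); pose V t := v (clamp r t).
pose U' t := u (clamp s t); pose V' t := v (clamp s t).
have UV t : U t ^+ 2 + V t ^+ 2 = 1 by exact: uv.
have UV' t : U' t ^+ 2 + V' t ^+ 2 = 1 by exact: uv.
have c0 t : 0 < U t * U' t + V t * V' t.
  have near : `|clamp r t - clamp s t| < Num.min d1 d2.
    by apply: le_lt_trans sr; exact: clamp_clamp.
  have rI : clamp r t \in `[0, 1].
    have := clamp_range t r0; rewrite !in_itv /= => /andP[-> ?] /=; lra.
  move: near; rewrite lt_min => /andP[/(ud _ _ rI) + /(vd _ _ rI)].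
  rewrite -/(U t) -/(U' t) -/(V t) -/(V' t) !ltr_norml.
  move=> /andP[? ?] /andP[? ?]; have := UV t; have := UV' t; nra.
exists (fun t => g t + atan ((U t * V' t - V t * U' t)
  / (U t * U' t + V t * V' t))
  / (2 * pi)); split.
  move=> t; apply: cvgD; first exact: gc.
  apply: cvgM; last exact: cvg_cst.
  apply: (@continuous_comp _ _ _
    (fun t => (U t * V' t - V t * U' t) / (U t * U' t + V t * V' t)) atan);
    last exact: continuous_atan.
  have Uc := uvc _ r uc; have Vc := uvc _ r vc.
  have Uc' := uvc _ s uc; have Vc' := uvc _ s vc.
  apply: cvgM; first by apply: cvgB; apply: cvgM;
    first [exact: Uc | exact: Vc | exact: Uc' | exact: Vc'].
  apply: cvgV; first by rewrite gt_eqF.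
  by apply: cvgD; apply: cvgM;
    first [exact: Uc | exact: Vc | exact: Uc' | exact: Vc'].
move=> t; rewrite mulrDr angleK cosD sinD.
have [-> ->] := gP t; rewrite -/(U t) -/(V t) -/(U' t) -/(V' t).
have [|-> ->] := cos_sin_atan (s := U t * V' t - V t * U' t) (c0 t).
  by rewrite -[RHS](mulr1 1) -{1}(UV t) -(UV' t); ring.
by split; [rewrite -[RHS]mul1r -(UV t) | rewrite -[RHS]mul1r -(UV t)]; ring.
Qed.

Lemma continuous_sum (R : realType) (n : nat) (f : 'I_n -> R -> R) :
  (forall i, continuous (f i)) -> continuous (fun t => \sum_i f i t).
Proof.
by move=> fc; apply: continuous_big => [|i _];
  [exact: add_continuous | exact: fc].
Qed.

(** For orthogonal unit vectors the squares of the differences of the products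
    add up to [2], which is too much for differences this small. *)
Lemma unit_vector_close (R : realType) (n : nat) (x y : 'I_n -> R) :
  \sum_i x i ^+ 2 = 1 -> \sum_i y i ^+ 2 = 1 ->
  (forall i j, `|x i * x j - y i * y j| < n.+1%:R^-1) ->
  \sum_i x i * y i != 0.
Proof.
move=> x1 y1 xy; apply/eqP => w0.
have n10 : (0 : R) < n.+1%:R^-1 by rewrite invr_gt0 ltr0n.
have : \sum_i \sum_j (x i * x j - y i * y j) ^+ 2 <=
    \sum_(i < n) \sum_(j < n) (n.+1%:R^-1) ^+ 2.
  apply: ler_sum => i _; apply: ler_sum => j _.
  by rewrite -[leLHS]real_normK ?num_real // lerXn2r ?nnegrE // ltW.
have -> : \sum_i \sum_j (x i * x j - y i * y j) ^+ 2 = 2.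
  transitivity (\sum_i \sum_j x i ^+ 2 * x j ^+ 2 +
      \sum_i \sum_j y i ^+ 2 * y j ^+ 2 -
      2 * \sum_i \sum_j (x i * y i) * (x j * y j)).
    rewrite mulr_sumr -big_split -sumrB /=; apply: eq_bigr => i _.
    rewrite mulr_sumr -big_split -sumrB /=; apply: eq_bigr => j _; ring.
  rewrite -!big_distrlr /= x1 y1 w0; ring.
rewrite !sumr_const !card_ord -mulrnA -[X in _ <= X]mulr_natr natrM => le2.
pose z : R := n%:R / n.+1%:R.
have z1 : z < 1 by rewrite ltr_pdivrMr ?ltr0n // mul1r ltr_nat.
have z0 : 0 <= z by rewrite divr_ge0.
have : 2 <= z ^+ 2 by rewrite [z ^+ 2](_ :
  _ = n.+1%:R^-1 ^+ 2 * (n%:R * n%:R)) // /z; ring.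
nra.
Qed.

(** The entries [x i * x j] of the projection onto the line of [x] determine [x]
    up to its sign.  The next lift is the projection of the old one to the new
    line, rescaled to a unit vector. *)
Lemma projective_path_lift (R : realType) (n : nat) (M :
  'I_n -> 'I_n -> R -> R) :
  (forall i j, continuous (M i j)) ->
  (forall t, exists m : 'I_n -> R,
    \sum_i m i ^+ 2 = 1 /\ forall i j, M i j t = m i * m j) ->
  exists g : R -> 'I_n -> R, (forall i, continuous (g^~ i)) /\
    {in `[0, 1], forall t, \sum_i g t i ^+ 2 = 1 /\
                           forall i j, M i j t = g t i * g t j}.
Proof.
move=> Mc MP.
have n10 : (0 : R) < n.+1%:R^-1 by rewrite invr_gt0 ltr0n.
have [d d0 Mu] : exists2 d : R, 0 < d & forall i j s t, s \in `[0, 1] ->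
    `|s - t| < d -> `|M i j s - M i j t| < n.+1%:R^-1.
  have [D DP] : {D : 'I_n -> 'I_n -> R & forall i j, 0 < D i j /\
    forall s t, s \in `[0,
      1] -> `|s - t| < D i j -> `|M i j s - M i j t| < n.+1%:R^-1}.
    have cD i j : {D : R | 0 < D /\ forall s t, s \in `[0, 1] -> `|s - t| < D ->
        `|M i j s - M i j t| < n.+1%:R^-1}.
      by apply: cid; have [D D0 DP] := uniformly_continuous_segment 0 1 (Mc i
        j) n10; exists D.
    by exists (fun i j => sval (cD i j)) => i j; exact: svalP (cD i j).
  exists (\big[Num.min/1]_(ij : 'I_n * 'I_n) D ij.1 ij.2).
    by apply: lt_bigmin => // -[i j] _; have [] := DP i j.
  move=> i j s t sI st; have [_] := DP i j; apply => //.
  by apply: lt_le_trans st _;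
    exact: (bigmin_le 1 (i, j) (fun ij => D ij.1 ij.2)).
apply: (@lift_by_steps R ('I_n -> R) (fun g => forall i, continuous (g^~ i))
  (fun x t => \sum_i x i ^+ 2 = 1 /\ forall i j, M i j t = x i * x j) d) => //.
  have [m mP] := MP 0; exists (fun=> m); split => // i t; exact: cvg_cst.
move=> g r s r0 rs s1 sr gc gP.
pose q t := \sum_i \sum_j g t i * M i j (clamp s t) * g t j.
have qE t (m : 'I_n -> R) : (forall i j, M i j (clamp s t) = m i * m j) ->
    q t = (\sum_i g t i * m i) ^+ 2.
  move=> mP; rewrite expr2 big_distrlr /=; apply: eq_bigr => i _.
  by apply: eq_bigr => j _; rewrite mP; ring.
have q0 t : 0 < q t.
  have [m [m1 mP]] := MP (clamp s t); have [g1 gM] := gP t.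
  rewrite (qE t m mP) exprn_even_gt0 //=; apply: unit_vector_close => // i j.
  rewrite -gM -mP; apply: Mu.
    have := clamp_range t r0; rewrite !in_itv /= => /andP[-> ?] /=; lra.
  by apply: le_lt_trans sr; exact: clamp_clamp.
have Msc i j : continuous (fun t => M i j (clamp s t)).
  by move=> t; apply: continuous_comp; [exact: continuous_clamp | exact: Mc].
exists (fun t i => (\sum_j M i j (clamp s t) * g t j) / Num.sqrt (q t)); split.
  move=> i t; apply: cvgM.
    apply: (continuous_sum (f := fun j t => M i j (clamp s t) * g t j)) => j u.
    by apply: cvgM; [exact: Msc | exact: gc].
  apply: cvgV; first by rewrite gt_eqF // sqrtr_gt0.
  apply: continuous_comp; last exact: sqrt_continuous.
  apply: (continuous_sum (f := fun i t => _)) => {}i.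
  apply: (continuous_sum (f := fun j t => _)) => j u.
  by apply: cvgM; [apply: cvgM; [exact: gc | exact: Msc] | exact: gc].
move=> t; have [m [m1 mP]] := MP (clamp s t).
pose w := \sum_i g t i * m i; have qw : q t = w ^+ 2 by exact: qE.
have w0 : w ^+ 2 != 0 by rewrite -qw gt_eqF.
have sw : Num.sqrt (q t) ^+ 2 = w ^+ 2 by rewrite sqr_sqrtr ?ltW // qw.
have sw0 : Num.sqrt (q t) != 0 by rewrite gt_eqF // sqrtr_gt0.
have gE i : \sum_j M i j (clamp s t) * g t j = m i * w.
  by rewrite mulr_sumr; apply: eq_bigr => j _; rewrite mP; ring.
split=> [|i j].
  rewrite -m1; apply: eq_bigr => i _.
  by rewrite gE !exprMn exprVn sw mulfK.
rewrite mP !gE.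
have -> : m i * w / Num.sqrt (q t) * (m j * w / Num.sqrt (q t)) =
   m i * m j * w ^+ 2 / Num.sqrt (q t) ^+ 2 by field.
by rewrite sw mulfK.
Qed.

(** * The projective plane *)

Section Projective.
Variable R : realType.
Implicit Types (x z : 'I_3 -> R) (y : projective_plane R).

Definition dot x z : R := \sum_i x i * z i.

Lemma dotE x z : dot x z = x ord0 * z ord0 +
  (x (lift ord0 ord0) * z (lift ord0 ord0) + x ord_max * z ord_max).
Proof.
rewrite /dot !big_ord_recl big_ord0 addr0.
by have -> : lift ord0 (lift ord0 ord0) = ord_max :> 'I_3 by apply/val_inj.
Qed.

Lemma coord3_eq x z : x ord0 = z ord0 -> x (lift ord0 ord0) =
  z (lift ord0 ord0) ->
  x ord_max = z ord_max -> x = z.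
Proof.
move=> h0 h1 h2; apply/funext => i.
have [->|->|->] : [\/ i = ord0, i = lift ord0 ord0 | i = ord_max] => //.
case: i => [[|[|[|//]]] ?]; [apply: Or31 | apply: Or32 | apply: Or33];
  exact/val_inj.
Qed.

(** After division by the square root of [k], [u] and [v] complete [N] to an
    orthonormal basis.  As no choice of them is continuous in [N], the formula
    that serves in general fails somewhere: if [N] is on the last axis. *)
Lemma orthogonal_frame N : dot N N = 1 -> exists u v (k : R), 0 < k /\
  forall z, k * dot z z = k * dot z N ^+ 2 + dot z u ^+ 2 + dot z v ^+ 2.
Proof.
rewrite dotE; set a := N ord0; set b := N (lift ord0 ord0); set c := N ord_max.
move=> N1.
pose vec (p q s : R) (i : 'I_3) :=
  if i == ord0 then p else if i == ord_max then s else q.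
have vecE p q s z : dot z (vec p q s) =
    z ord0 * p + (z (lift ord0 ord0) * q + z ord_max * s) by rewrite dotE.
have [r0|r0] := eqVneq (a ^+ 2 + b ^+ 2) 0.
  exists (vec 1 0 0), (vec 0 1 0), 1; split=> [|z]; first exact: ltr01.
  have a0 : a = 0 by nra.
  have b0 : b = 0 by nra.
  have c2 : c * c = 1 by move: N1; rewrite a0 b0; lra.
  rewrite !vecE !dotE -/a -/b -/c a0 b0.
  move: (z ord0) (z (lift ord0 ord0)) (z ord_max) => z0 z1 z2.
  rewrite [X in _ = 1 * X ^+ 2 + _ + _](_ : _ = z2 * c); last by ring.
  rewrite exprMn [c ^+ 2]c2; ring.
have r_gt0 : 0 < a ^+ 2 + b ^+ 2.
  by rewrite lt_neqAle eq_sym r0 addr_ge0 ?sqr_ge0.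
exists (vec (- b) a 0), (vec (- c * a) (- c * b) (a ^+ 2 + b ^+ 2)),
  (a ^+ 2 + b ^+ 2).
split=> // z; rewrite !vecE !dotE -/a -/b -/c.
move: (z ord0) (z (lift ord0 ord0)) (z ord_max) => z0 z1 z2.
rewrite -[LHS](mul1r) -[X in _ = _ + X + _](mul1r) -N1; ring.
Qed.

Section Stereographic.
Variables (N u v : 'I_3 -> R) (k : R).
Hypothesis (k0 : 0 < k)
  (frame : forall z, k * dot z z =
    k * dot z N ^+ 2 + dot z u ^+ 2 + dot z v ^+ 2).

(** The projection from the point [N] of the sphere. *)
Definition stereographic z : plane R :=
  point2 (dot z u / (1 - dot z N)) (dot z v / (1 - dot z N)).

Lemma dotB z z' w : dot (fun i => z i - z' i) w = dot z w - dot z' w.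
Proof. by rewrite !dotE; ring. Qed.

Lemma stereographic_inj z z' : dot z z = 1 -> dot z' z' = 1 ->
  dot z N != 1 -> dot z' N != 1 -> stereographic z = stereographic z' -> z = z'.
Proof.
move=> z1 z1' zN zN' /point2_inj[]; have := frame z; have := frame z'.
have := frame (fun i => z i - z' i).
rewrite (dotB _ _ N) (dotB _ _ u) (dotB _ _ v) z1 z1'.
have : dot (fun i => z i - z' i) (fun i => z i - z' i) = 0 -> z = z'.
  rewrite dotE -!expr2 => /eqP; rewrite !paddr_eq0 ?addr_ge0 ?sqr_ge0 //.
  by rewrite !sqrf_eq0 !subr_eq0 => /and3P[/eqP ? /eqP ? /eqP ?];
    exact: coord3_eq.
move: (dot z N) (dot z' N) (dot z u) (dot z' u) (dot z v) (dot z' v) zN zN'.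
move: (dot _ _).
move=> D a a' b b' c c' a1 a1' D0 FD F' F hb hc; apply: D0.
have n1 : 1 - a != 0 by rewrite subr_eq0 eq_sym.
have n1' : 1 - a' != 0 by rewrite subr_eq0 eq_sym.
pose p := b / (1 - a); pose q := c / (1 - a).
have bE : b = p * (1 - a) by rewrite /p divfK.
have cE : c = q * (1 - a) by rewrite /q divfK.
have bE' : b' = p * (1 - a') by rewrite /p hb divfK.
have cE' : c' = q * (1 - a') by rewrite /q hc divfK.
have h : k * (1 + a) = (p ^+ 2 + q ^+ 2) * (1 - a).
  apply: (mulIf n1); rewrite [RHS](_ : _ = b ^+ 2 + c ^+ 2);
    last by rewrite bE cE; ring.
  lra.
have h' : k * (1 + a') = (p ^+ 2 + q ^+ 2) * (1 - a').
  apply: (mulIf n1'); rewrite [RHS](_ : _ = b' ^+ 2 + c' ^+ 2);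
    last by rewrite bE' cE'; ring.
  lra.
have aE : a = a'.
  have h2 : (k + (p ^+ 2 + q ^+ 2)) * (a - a') = 0 by lra.
  have s0 : k + (p ^+ 2 + q ^+ 2) != 0.
    by rewrite gt_eqF // ltr_wpDr ?addr_ge0 ?sqr_ge0.
  by move/eqP: h2; rewrite mulf_eq0 (negbTE s0) /= subr_eq0 => /eqP.
have bb : b = b' by rewrite bE bE' aE.
have cc : c = c' by rewrite cE cE' aE.
have kD : k * D = 0 by rewrite FD aE bb cc; ring.
by move/eqP: kD; rewrite mulf_eq0 gt_eqF //= => /eqP.
Qed.

Lemma continuous_dot (f : R -> 'I_3 -> R) w :
  (forall i, continuous (f^~ i)) -> continuous (fun t => dot (f t) w).
Proof.
move=> fc; apply: (continuous_sum (f := fun i t => f t i * w i)) => i t.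
by apply: cvgM; [exact: fc | exact: cvg_cst].
Qed.

Lemma continuous_stereographic (f : R -> 'I_3 -> R) :
  (forall i, continuous (f^~ i)) -> (forall t, dot (f t) N != 1) ->
  continuous (fun t => stereographic (f t)).
Proof.
move=> fc fN; apply: continuous_point2 => t;
  (apply: cvgM; first exact: continuous_dot; apply: cvgV;
    [by rewrite subr_eq0 eq_sym | apply: cvgB;
      [exact: cvg_cst | exact: continuous_dot]]).
Qed.

End Stereographic.

(** The line [y] is spanned by the unit vector [x].  The products of coordinates
    do not see the sign of the representative of [y]. *)
Definition represents x y : Prop :=
  dot x x = 1 /\ forall i j, val (repr y) ord0 i * val (repr y) ord0 j =
    x i * x j.

Definition signv (b : bool) x : 'I_3 -> R := fun i => (-1) ^+ b * x i.

Lemma signv_dot b x z : dot (signv b x) z = (-1) ^+ b * dot x z.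
Proof. by rewrite !dotE /signv; ring. Qed.

Lemma signv_unit b x : dot (signv b x) (signv b x) = dot x x.
Proof. by rewrite !dotE /signv; case: b; rewrite ?expr0 ?expr1; ring. Qed.

Lemma unit_opp x z : dot x x = 1 -> dot z z = 1 ->
  (forall i j, z i * z j = x i * x j) -> exists b, z = signv b x.
Proof.
move=> x1 z1 xz; have zE i : z i = dot x z * x i.
  rewrite -[LHS]mulr1 -z1 /dot mulr_sumr mulr_suml; apply: eq_bigr => j _.
  by rewrite mulrA xz; ring.
have : dot x z ^+ 2 = 1.
  rewrite -z1 [RHS]/dot; under eq_bigr do rewrite zE.
  have -> : \sum_i dot x z * x i * (dot x z * x i) = dot x z ^+ 2 * dot x x.
    by rewrite [dot x x]/dot mulr_sumr; apply: eq_bigr => i _; ring.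
  by rewrite x1 mulr1.
move=> /eqP; rewrite sqrf_eq1 => /orP[]/eqP xz1.
  by exists false; apply/funext => i; rewrite /signv expr0 zE xz1.
by exists true; apply/funext => i; rewrite /signv expr1 zE xz1.
Qed.

Lemma represents_opp b x y : represents x y -> represents (signv b x) y.
Proof.
move=> [x1 xy]; split=> [|i j]; first by rewrite signv_unit.
by rewrite xy /signv; case: b; rewrite ?expr0 ?expr1; ring.
Qed.

Lemma sphere_dot (s : set_type (sphere R 2)) :
  dot (fun i => val s ord0 i) (fun i => val s ord0 i) = 1.
Proof.
transitivity (\sum_i val s ord0 i ^+ 2); last exact: (set_valP s).
by apply: eq_bigr => i _; rewrite expr2.
Qed.

Lemma represents_repr y : represents (fun i => val (repr y) ord0 i) y.
Proof. by split => //; exact: sphere_dot. Qed.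

Lemma represents_unique x y y' : represents x y -> represents x y' -> y = y'.
Proof.
move=> [_ xy] [_ xy'].
have [i j|b h] := unit_opp (sphere_dot (repr y)) (sphere_dot (repr y')).
  by rewrite xy xy'.
have anti : antipodal (repr y) (repr y').
  rewrite /antipodal; move: h; case: b => h; apply/orP; [right | left];
    apply/eqP/rowP => i.
    by have := congr1 (@^~ i) h; rewrite /signv expr1 mulN1r mxE => ->;
      rewrite opprK.
  by have := congr1 (@^~ i) h; rewrite /signv expr0 mul1r => ->.
have /eqmodP pi_eq : antipodal_equiv R (repr y) (repr y') by [].
by rewrite -[y]reprK -[y']reprK.
Qed.

Lemma represents_sign x x' y :
  represents x y -> represents x' y -> exists b, x' = signv b x.
Proof. by move=> [x1 xy] [x1' xy']; apply: unit_opp => // i j;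
  rewrite -xy -xy'. Qed.

Lemma signv_inj b b' x : dot x x = 1 -> signv b x = signv b' x -> b = b'.
Proof.
by move=> x1 /(congr1 (dot^~ x)); rewrite !signv_dot x1 !mulr1 => /signr_inj.
Qed.

Lemma continuous_entry i j :
  continuous (fun y => val (repr y) ord0 i * val (repr y) ord0 j).
Proof.
apply: (repr_comp_continuous (g := fun x :
  set_type (sphere R 2) => val x ord0 i * val x ord0 j)).
  by move=> x; apply: continuousM; exact: continuous_sphere_coord.
move=> x z /eqP/(@eqmodP _ (antipodal_equiv R)).
rewrite /= /antipodal => /orP[]/eqP ->; rewrite ?mxE ?mulrNN; exact: eqxx.
Qed.

Lemma sphere_dot_eq1 x z : dot x x = 1 -> dot z z = 1 -> dot x z = 1 -> x = z.
Proof.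
rewrite !dotE => x1 z1 xz.
have /eqP : (x ord0 - z ord0) ^+ 2 + ((x (lift ord0 ord0) - z (lift ord0 ord0))
  ^+ 2 +
  (x ord_max - z ord_max) ^+ 2) = 0 by lra.
rewrite !paddr_eq0 ?addr_ge0 ?sqr_ge0 // !sqrf_eq0 !subr_eq0.
by move=> /and3P[/eqP ? /eqP ? /eqP ?]; exact: coord3_eq.
Qed.

(** An arc of the projective plane lifts to an arc of the sphere from a given
    representative [x] of its origin; its end represents the end of the arc, so
    it is [z] up to a sign. *)
Lemma projective_arc_lift (c : R -> projective_plane R) x z :
  {within `[0, 1], continuous c} -> represents x (c 0) -> represents z (c 1) ->
  exists (e : R -> 'I_3 -> R) (s : bool),
    [/\ forall i, continuous (e^~ i), e 0 = x, e 1 = signv s z &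
        forall t, represents (e t) (c (clamp 1 t))].
Proof.
move=> /continuous_clamp_comp cc xc zc.
pose M i j t := val (repr (c (clamp 1 t))) ord0 i * val (repr (c (clamp 1 t)))
  ord0 j.
have Mc i j : continuous (M i j).
  move=> t; apply: (@continuous_comp _ _ _ (c \o clamp 1)
    (fun y => val (repr y) ord0 i * val (repr y) ord0 j)); first exact: cc.
  exact: continuous_entry.
have [|g [gc gP]] := projective_path_lift Mc.
  move=> t; exists (fun i => val (repr (c (clamp 1 t))) ord0 i); split => //.
  by rewrite -[RHS](sphere_dot (repr (c (clamp 1 t)))); apply: eq_bigr => i _;
    rewrite expr2.
have grep t : represents (g (clamp 1 t)) (c (clamp 1 t)).
  have tI : clamp 1 t \in `[0, 1] by exact: clamp_range.
  have [g1 gM] := gP _ tI; split.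
    by rewrite -[RHS]g1; apply: eq_bigr => i _; rewrite expr2.
  by move=> i j; rewrite -gM /M (clamp_in tI).
have c0 : clamp 1 0 = 0 :> R by rewrite clamp_in ?in_cc0.
have c1 : clamp 1 1 = 1 :> R by rewrite clamp_in ?in_cc1.
have := grep 0; have := grep 1; rewrite c0 c1 => g1c g0c.
have [b bE] := represents_sign g0c xc.
have [s sE] := represents_sign zc (represents_opp b g1c).
exists (fun t => signv b (g (clamp 1 t))), s; split; rewrite ?c0 ?c1 //.
  move=> i t; apply: cvgM; first exact: cvg_cst.
  by apply: (@continuous_comp _ _ _ (clamp 1) (g^~ i));
    [exact: continuous_clamp | exact: gc].
by move=> t; exact: represents_opp.
Qed.

(** The double cover of a graph drawn in the projective plane is drawn on the
    sphere.  It has two copies of each edge and one of them suffices, so the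
    sphere can be projected from a point in the middle of another one. *)
Lemma splittable_projective_plane (G : sgraph) :
  embeddable R (projective_plane R) G -> splittable R 2 G.
Proof.
move=> [p [c drawn]].
have [[x0 [y0 [xy0 o0]]]|noedge] := pselect (exists x y :
  G, adj x y /\ ordered x y); last first.
  apply/splittable_planar/embeddable_edgeless => x y; apply/negP => xy.
  apply: noedge; have [oxy|nxy] := boolP (ordered x y); first by exists x, y.
  by exists y, x; rewrite adj_sym (orderedN xy (negbTE nxy)).
have [pinj arc vert cross] := drawn.
(* The copy of a vertex [v] with the label [true] is at the point opposite to
   [P0 v]; [sg v w] tells at which copy of [w] the lift that starts at [P0 v]
   ends. *)
pose P0 (v : G) : 'I_3 -> R := fun i => val (repr (p v)) ord0 i.
have P0P v : represents (P0 v) (p v) by exact: represents_repr.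
have lift v w : {es : (R -> 'I_3 -> R) * bool | adj v w ->
    [/\ forall i, continuous (es.1^~ i), es.1 0 = P0 v, es.1 1 =
      signv es.2 (P0 w) &
        forall t, represents (es.1 t) (c v w (clamp 1 t))]}.
  apply: cid; have [vw|//] := boolP (adj v w);
    last by exists ((fun=> P0 v), false).
  have [cc _ c0 c1 _] := arc _ _ vw.
  have [||e [s eP]] := projective_arc_lift (x := P0 v) (z := P0 w) cc;
    rewrite ?c0 ?c1 //.
  by exists (e, s).
pose e v w := (sval (lift v w)).1; pose sg v w := (sval (lift v w)).2.
have eP v w : adj v w -> [/\ forall i, continuous ((e v w)^~ i), e v w 0 = P0 v,
    e v w 1 = signv (sg v w) (P0 w) & forall t,
      represents (e v w t) (c v w (clamp 1 t))].
  exact: svalP (lift v w).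
pose sgn v w := if ordered v w then sg v w else sg w v.
(* The lift of the edge [x0 y0] at the copy [(x0, true)] is left out. *)
pose kept (h h' : G * bool) := ~~ ((h.1 == x0) && (h'.1 == y0) && h.2).
pose hadj (h h' : G * bool) :=
  [&& adj h.1 h'.1, h.2 (+) h'.2 == sgn h.1 h'.1, kept h h' & kept h' h].
have sgnC v w : adj v w -> sgn v w = sgn w v.
  move=> vw; rewrite /sgn; have [oo|no] := boolP (ordered v w).
    by rewrite ordered_asym.
  by rewrite (orderedN vw (negbTE no)).
have hsym : symmetric hadj.
  move=> h h'; rewrite /hadj adj_sym addbC [kept h h' && _]andbC.
  by have [/sgnC ->|//] := boolP (adj _ _).
have hirr : irreflexive hadj by move=> h; rewrite /hadj adj_irr.
pose H := SGraph hsym hirr.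
have x0y0 : x0 != y0 by apply/eqP => xyE; rewrite xyE adj_irr in xy0.
apply: (@splittable_cover R 2 G H fst).
- by move=> h h' /and4P[].
- move=> x y xy; have [/andP[/eqP xE /eqP yE]|nxy] := boolP ((x == y0)
    && (y == x0)).
    exists (x, sgn x y), (y, false); split => //=.
    by rewrite /hadj /kept /= xy addbF eqxx !xE !yE eqxx !andbF (negbTE x0y0)
      eq_sym (negbTE x0y0).
  exists (x, false), (y, sgn x y); split => //=.
  rewrite /hadj /kept /= xy eqxx andbF /=.
  by move: nxy; rewrite andbC => /negbTE ->.
- move=> x; apply: leq_trans (_ : #|[set (x, false); (x, true)]%SET| <= 2)%N.
    apply/subset_leq_card/fintype.subsetP => -[v b]; rewrite !inE /= => /eqP ->.
    by case: b; rewrite eqxx ?orbT.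
  by rewrite cards2; case: eqP.
pose half : R := 1 / 2.
have halfI : half \in `]0, 1[ by rewrite in_itv /= /half; apply/andP; split;
  lra.
pose N := signv true (e x0 y0 half).
have [_ _ _ e0rep] := eP _ _ xy0.
have NP : represents N (c x0 y0 half).
  by apply: represents_opp; have := e0rep half; rewrite clamp_in // in_oo_cc.
have N1 : dot N N = 1 by case: NP.
have [u [v [k [k0 frame]]]] := orthogonal_frame N1.
pose f := stereographic N u v.
pose E (h h' : H) t := f (signv h.2 (e h.1 h'.1 t)).
pose P (h : H) := f (signv h.2 (P0 h.1)).
have dotN z : dot z z = 1 -> z <> N -> dot z N != 1.
  by move=> z1 zN; apply/eqP => /(sphere_dot_eq1 z1 N1).
have Pavoid (h : H) : dot (signv h.2 (P0 h.1)) N != 1.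
  have rep : represents (signv h.2 (P0 h.1)) (p h.1)
    by exact/represents_opp/P0P.
  apply: dotN => [|PN]; first by case: rep.
  rewrite PN in rep; apply: (vert _ _ h.1 xy0 _ halfI).
  exact: represents_unique NP rep.
have Eavoid (h h' : H) t : adj h h' -> ordered h.1 h'.1 ->
    dot (signv h.2 (e h.1 h'.1 t)) N != 1.
  move=> /and4P[hh' _ keep _] oh; have [_ e0 e1 erep] := eP _ _ hh'.
  have rep : represents (signv h.2 (e h.1 h'.1 t)) (c h.1 h'.1 (clamp 1 t)).
    by apply: represents_opp.
  apply: dotN => [|EN]; first by case: rep.
  rewrite EN in rep; have ceq := represents_unique rep NP.
  have tI : clamp 1 t \in `[0, 1] by exact: clamp_range.
  have [_ _ c0 c1 _] := arc _ _ hh'.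
  have [t0|t0] := eqVneq (clamp 1 t) 0.
    by apply: (vert _ _ h.1 xy0 _ halfI); rewrite -ceq t0 c0.
  have [t1|t1] := eqVneq (clamp 1 t) 1.
    by apply: (vert _ _ h'.1 xy0 _ halfI); rewrite -ceq t1 c1.
  have tI' : clamp 1 t \in `]0, 1[.
    move: tI; rewrite !in_itv /= => /andP[? ?].
    by rewrite !lt_neqAle eq_sym t0 t1; apply/andP; split.
  have [[xE yE]|[xE yE]] := cross _ _ _ _ hh' xy0 _ _ tI' halfI ceq; last first.
    by move: oh; rewrite -xE -yE ordered_asym.
  have [_ cinj _ _ _] := arc _ _ hh'.
  have tE : clamp 1 t = half.
    by apply: cinj; rewrite ?(in_oo_cc halfI) // ceq xE yE.
  have th : t = half.
    have [t_le0|t_gt0] := lerP t 0; first by rewrite clamp_le0 ?eqxx in t0.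
    have [t_le1|t_gt1] := lerP t 1; last by rewrite clamp_ge ?eqxx // ltW in t1.
    by rewrite -tE clamp_in // in_itv /= t_le1 ltW.
  move: EN; rewrite /N th xE yE => /signv_inj h2.
  have [e1' _] := erep half.
  by move: keep; rewrite /kept -xE -yE !eqxx (h2 e1').
pose rho w y := exists z, [/\ dot z N != 1, w = f z & represents z y].
apply: (@embeddable_lift R (plane R) (projective_plane R) G H p c (fst :
  H -> G) rho P E drawn) => //.
- by move=> h h' /and4P[].
- move=> w y y' [z [zN -> zy]] [z' [zN' zz' zy']].
  have zE : z = z'.
    by apply: (stereographic_inj k0 frame) zz' => //; [case: zy | case: zy'].
  by apply: represents_unique zy _; rewrite zE.
- move=> [x b] [x' b'] PP.
  have rep (h : H) : represents (signv h.2 (P0 h.1)) (p h.1)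
    by exact/represents_opp/P0P.
  have zE : signv b (P0 x) = signv b' (P0 x').
    apply: (stereographic_inj k0 frame) PP; try exact: (Pavoid (_, _)).
      by case: (rep (x, b)).
    by case: (rep (x', b')).
  have xx : x = x'.
    apply/pinj; apply: represents_unique (rep (x, b)) _ => /=.
    by rewrite zE; exact: (rep (x', b')).
  by rewrite -xx in zE *; congr pair; apply: signv_inj zE; case: (P0P x).
- move=> h; exists (signv h.2 (P0 h.1)); split; [exact: Pavoid | by [] |].
  exact/represents_opp/P0P.
- move=> h h' hh' oh; have /and4P[vw /eqP bb _ _] := hh'.
  have [ec e0 e1 erep] := eP _ _ vw; split.
  + apply: continuous_stereographic => [i|t]; last exact: Eavoid.
    by move=> t; apply: cvgM; [exact: cvg_cst | exact: ec].
  + by rewrite /E e0.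
  + rewrite /E e1 /P; congr f; apply/funext => i;
      rewrite /signv mulrA -signr_addb.
    by congr (_ * _); move: bb; rewrite /sgn oh => <-; rewrite addKb.
  + move=> t tI; exists (signv h.2 (e h.1 h'.1 t)); split;
      [exact: Eavoid | by [] |].
    by apply: represents_opp; have := erep t; rewrite clamp_in.
- move=> h h' l l' hh' ll' oh hl hl' t tI EE.
  have ol : ordered l.1 l'.1 by rewrite -hl -hl'.
  have /and4P[vw /eqP bb _ _] := hh'; have /and4P[vw' /eqP bb' _ _] := ll'.
  have [_ _ _ erep] := eP _ _ vw; have [e1 _] := erep t.
  have zE : signv h.2 (e h.1 h'.1 t) = signv l.2 (e h.1 h'.1 t).
    move: EE; rewrite /E -hl -hl' => EE.
    apply: (stereographic_inj k0 frame) EE; rewrite ?signv_unit //.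
      exact: Eavoid.
    by rewrite hl hl'; exact: Eavoid.
  have h2 := signv_inj e1 zE.
  case: h h' l l' {zE EE e1 erep ll' hh' vw vw'} hl hl' oh ol bb bb' h2 =>
    x b [x' b'] [z d] [z' d'] /=.
  move=> -> -> oh _ bb bb' h2; rewrite h2 in bb *; split=> //; congr pair.
  by rewrite -(addKb d b') -(addKb d d') bb bb'.
Qed.

End Projective.

(** * The plane as a covering space of the torus *)

Section TorusCover.
Variable R : realType.
Implicit Types (z w : R * R) (k l : int * int) (y : torus R).

Definition lattice k : R * R := (k.1%:~R, k.2%:~R).

Lemma latticeD k l : lattice (k + l) = lattice k + lattice l.
Proof. by rewrite /lattice /= !intrD. Qed.

Lemma latticeN k : lattice (- k) = - lattice k.
Proof. by rewrite /lattice /= !intrN. Qed.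

Lemma lattice_inj : injective lattice.
Proof. by move=> [a b] [a' b'] [] /eqP + /eqP;
  rewrite !eqr_int => /eqP -> /eqP ->. Qed.

(** The torus is a product of circles, and the point of the circle over a real
    number [a] is at the angle [2 * pi * a]. *)
Definition covers_circle (a : R) (s : set_type (sphere R 1)) : Prop :=
  cos (2 * pi * a) = val s ord0 ord0 /\ sin (2 * pi * a) = val s ord0 ord_max.

Definition covers z y : Prop := covers_circle z.1 y.1 /\ covers_circle z.2 y.2.

Lemma sphere1_eq1 (s : set_type (sphere R 1)) :
  val s ord0 ord0 ^+ 2 + val s ord0 ord_max ^+ 2 = 1.
Proof.
have := set_valP s; rewrite /sphere /= => s1.
transitivity (\sum_i val s ord0 i ^+ 2); last exact: s1.
rewrite !big_ord_recl big_ord0 addr0.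
by have -> : lift ord0 ord0 = ord_max :> 'I_2 by apply/val_inj.
Qed.

Lemma covers_circle_unique a s s' :
  covers_circle a s -> covers_circle a s' -> s = s'.
Proof.
move=> [h1 h2] [h1' h2']; apply/val_inj/rowP => i.
have [->|->] : i = ord0 \/ i = ord_max; last by rewrite -h2.
  by case: i => [[|[|//]] ?]; [left | right]; exact/val_inj.
by rewrite -h1.
Qed.

Lemma covers_unique z y y' : covers z y -> covers z y' -> y = y'.
Proof.
case: y y' => [s t] [s' t'] [/= h1 h2] [/= h1' h2'].
by rewrite (covers_circle_unique h1 h1') (covers_circle_unique h2 h2').
Qed.

Lemma covers_lattice z y k : covers z y -> covers (z + lattice k) y.
Proof.
move=> [[h1 h2] [h3 h4]]; rewrite /covers /covers_circle /=.
have [-> ->] := cos_sin_2piD_int z.1 k.1;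
  have [-> ->] := cos_sin_2piD_int z.2 k.2.
by [].
Qed.

Lemma covers_fibre z w y :
  covers z y -> covers w y -> exists k, w = z + lattice k.
Proof.
move=> [[h1 h2] [h3 h4]] [[h1' h2'] [h3' h4']].
have [||a aE] := @cos_sin_2pi_eq R w.1 z.1;
  [by rewrite h1 h1' | by rewrite h2 h2' |].
have [||b bE] := @cos_sin_2pi_eq R w.2 z.2;
  [by rewrite h3 h3' | by rewrite h4 h4' |].
by exists (a, b); rewrite (surjective_pairing w) aE bE.
Qed.

Lemma covers_exists y : exists z, covers z y.
Proof.
have [a aP] := angle_exists (sphere1_eq1 y.1).
by have [b bP] := angle_exists (sphere1_eq1 y.2); exists (a, b).
Qed.

Lemma circle_arc_lift (c : R -> set_type (sphere R 1)) :
  continuous c -> exists th : R -> R,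
  continuous th /\ {in `[0, 1], forall t, covers_circle (th t) (c t)}.
Proof.
move=> cc.
have coc j : continuous (fun t => val (c t) ord0 j).
  move=> t; apply: (@continuous_comp _ _ _ c
    (fun s : set_type (sphere R 1) => val s ord0 j)); first exact: cc.
  exact: continuous_sphere_coord.
have [t|th [thc thP]] := circle_path_lift (coc ord0) (coc ord_max).
  exact: sphere1_eq1.
by exists th.
Qed.

(** The end of a lifted arc is only known up to a lattice vector. *)
Lemma torus_arc_lift (c : R -> torus R) z w :
  {within `[0, 1], continuous c} -> covers z (c 0) -> covers w (c 1) ->
  exists (e : R -> R * R) k,
    [/\ continuous (fun t => (e t).1) /\ continuous (fun t => (e t).2),
        e 0 = z, e 1 = w + lattice k & forall t, covers (e t) (c (clamp 1 t))].
Proof.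
move=> cc z0 w1.
have {}cc := continuous_clamp_comp cc.
have [|a [ac aP]] := @circle_arc_lift (fst \o (c \o clamp 1)).
  by move=> t; apply: continuous_comp; [exact: cc | exact: cvg_fst].
have [|b [bc bP]] := @circle_arc_lift (snd \o (c \o clamp 1)).
  by move=> t; apply: continuous_comp; [exact: cc | exact: cvg_snd].
have c0 : clamp 1 0 = 0 :> R by rewrite clamp_in ?in_cc0.
have c1 : clamp 1 1 = 1 :> R by rewrite clamp_in ?in_cc1.
have abP t : covers (a (clamp 1 t), b (clamp 1 t)) (c (clamp 1 t)).
  have tI : clamp 1 t \in `[0, 1] by exact: clamp_range.
  by split; [have := aP _ tI | have := bP _ tI]; rewrite /= (clamp_in tI).
have := abP 0; have := abP 1; rewrite c0 c1 => ab1 ab0.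
have [k kE] := covers_fibre ab0 z0.
have [l lE] := covers_fibre w1 (covers_lattice k ab1).
exists (fun t => (a (clamp 1 t), b (clamp 1 t)) + lattice k), l.
split; rewrite ?c0 ?c1 //; last by move=> t; exact: covers_lattice.
have clampc (f : R -> R) : continuous f -> continuous (f \o clamp 1).
  by move=> fc t; apply: continuous_comp; [exact: continuous_clamp | exact: fc].
by split=> t; (apply: cvgD; last exact: cvg_cst);
  [exact: (clampc a) | exact: (clampc b)].
Qed.

End TorusCover.

(** * Lifts of drawings and of walks *)

(** A drawing in the torus whose arcs are lifted to the plane; [d x y] is the
    lattice vector by which the lift of the arc from [x] to [y] that starts at
    the chosen lift of [x] misses the chosen lift of [y]. *)
Record lifted_drawing (R : realType) (G : sgraph) (p : G -> torus R)
    (c : G -> G -> R -> torus R) (P : G -> R * R) (e : G -> G -> R -> R * R)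
    (d : G -> G -> int * int) : Prop := LiftedDrawing {
  lifted_drawn : drawing p c;
  lifted_vertex : forall x, covers (P x) (p x);
  lifted_continuous : forall x y, adj x y ->
    continuous (fun t => (e x y t).1) /\ continuous (fun t => (e x y t).2);
  lifted_start : forall x y, adj x y -> e x y 0 = P x;
  lifted_end : forall x y, adj x y -> e x y 1 = P y + lattice R (d x y);
  lifted_covers : forall x y, adj x y ->
    {in `[0, 1], forall t, covers (e x y t) (c x y t)};
  lifted_rev : forall x y, adj x y -> forall t,
    e y x t = e x y (1 - t) - lattice R (d x y);
  lifted_shift_rev : forall x y, adj x y -> d y x = - d x y }.

Lemma lifted_drawing_exists (R : realType) (G : sgraph) (p : G -> torus R)
    (c : G -> G -> R -> torus R) :
  drawing p c -> exists P e d, lifted_drawing p c P e d.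
Proof.
move=> drawn; have [pinj arc vert cross] := drawn.
pose P x := sval (cid (covers_exists (p x))).
have PP x : covers (P x) (p x) by exact: svalP (cid (covers_exists (p x))).
have lift x y : {ek : (R -> R * R) * (int * int) | adj x y ->
    [/\ continuous (fun t => (ek.1 t).1) /\ continuous (fun t => (ek.1 t).2),
        ek.1 0 = P x, ek.1 1 = P y + lattice R ek.2 &
        forall t, covers (ek.1 t) (c x y (clamp 1 t))]}.
  apply: cid; have [xy|//] := boolP (adj x y); last by exists ((fun=> P x), 0).
  have [cc _ c0 c1 _] := arc _ _ xy.
  have [||e [k ekP]] := torus_arc_lift (z := P x) (w := P y) cc;
    rewrite ?c0 ?c1 //.
  by exists (e, k).
pose e0 x y := (sval (lift x y)).1; pose d0 x y := (sval (lift x y)).2.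
have liftP x y : adj x y -> [/\ continuous (fun t =>
  (e0 x y t).1) /\ continuous (fun t => (e0 x y t).2),
        e0 x y 0 = P x, e0 x y 1 = P y + lattice R (d0 x y) &
        forall t, covers (e0 x y t) (c x y (clamp 1 t))].
  exact: svalP (lift x y).
pose d x y := if ordered x y then d0 x y else - d0 y x.
pose e x y t := if ordered x y then e0 x y t else e0 y x (1 - t)
  - lattice R (d0 y x).
have subc (f : R -> R) : continuous f -> continuous (fun t : R => f (1 - t)).
  move=> fc t; apply: continuous_comp; last exact: fc.
  by apply: cvgB; [exact: cvg_cst | exact: cvg_id].
exists P, e, d; split=> //.
- move=> x y xy; rewrite /e; have [oxy|/negbTE nxy] := boolP (ordered x y).
    by have [[ec1 ec2] _ _ _] := liftP _ _ xy.
  rewrite adj_sym in xy; have [[ec1 ec2] _ _ _] := liftP _ _ xy.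
  by split=> t; (apply: cvgB; last exact: cvg_cst);
    [exact: (subc _ ec1) | exact: (subc _ ec2)].
- move=> x y xy; rewrite /e; case: ifP => [oxy|/(orderedN xy) oyx].
    by have [_ -> _ _] := liftP _ _ xy.
  by rewrite adj_sym in xy; have [_ _ e1 _] := liftP _ _ xy;
    rewrite subr0 e1 addrK.
- move=> x y xy; rewrite /e /d; case: ifP => [oxy|/(orderedN xy) oyx].
    by have [_ _ -> _] := liftP _ _ xy.
  rewrite adj_sym in xy; have [_ e0E _ _] := liftP _ _ xy.
  by rewrite subrr e0E latticeN.
- move=> x y xy t tI; rewrite /e; case: ifP => [oxy|/(orderedN xy) oyx].
    by have [_ _ _ /(_ t)] := liftP _ _ xy; rewrite clamp_in.
  have yx : adj y x by rewrite adj_sym.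
  have [_ _ _ /(_ (1 - t))] := liftP _ _ yx;
    rewrite clamp_in ?in_cc1B // => cov.
  have [_ _ _ _ /(_ t tI) crev] := arc _ _ yx.
  by rewrite crev -latticeN; exact: covers_lattice.
- move=> x y xy t; rewrite /e /d; have [oxy|nxy] := boolP (ordered x y).
    by rewrite ordered_asym.
  by rewrite (orderedN xy (negbTE nxy)) subKr latticeN opprK subrK.
- move=> x y xy; rewrite /d; have [oxy|nxy] := boolP (ordered x y).
    by rewrite ordered_asym.
  by rewrite (orderedN xy (negbTE nxy)) opprK.
Qed.

Section LiftedWalks.
Variables (R : realType) (G : sgraph) (p : G -> torus R)
  (c : G -> G -> R -> torus R) (P : G -> R * R) (e : G -> G -> R -> R * R)
  (d : G -> G -> int * int).
Hypothesis lifted : lifted_drawing p c P e d.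
Local Notation lattice := (lattice R).
Implicit Types (x y : G) (q r : seq G) (k l v : int * int).

Lemma lifted_vertex_inj x y k l :
  P x + lattice k = P y + lattice l -> x = y /\ k = l.
Proof.
move=> xy; have [pinj _ _ _] := lifted_drawn lifted.
have xyE : x = y.
  apply: pinj; apply: covers_unique (covers_lattice k (lifted_vertex lifted x))
    _.
  by rewrite xy; apply: covers_lattice; exact: (lifted_vertex lifted y).
by split=> //; move: xy; rewrite xyE => /addrI/lattice_inj.
Qed.

(** In the torus two arcs meet only at a common end, and a common point of two
    lifts of one arc shows that these lifts coincide. *)
Lemma lifted_arcs_meet x x' y y' k l s t : adj x x' -> adj y y' ->
  s \in `[0, 1] -> t \in `[0, 1] ->
  e x x' s + lattice k = e y y' t + lattice l ->
  exists a b : bool, (if a then x' else x) = (if b then y' else y) /\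
    k + (if a then d x x' else 0) = l + (if b then d y y' else 0).
Proof.
move=> xx yy sI tI est; have [pinj arc vert cross] := lifted_drawn lifted.
have ceq : c x x' s = c y y' t.
  apply: covers_unique (covers_lattice k (lifted_covers lifted xx sI)) _.
  by rewrite est; apply: covers_lattice; exact: (lifted_covers lifted yy tI).
have ends z z' m u : adj z z' -> u \in `[0, 1] -> (u \in `]0, 1[) \/
    exists a : bool, c z z' u = p (if a then z' else z) /\
      e z z' u + lattice m =
        P (if a then z' else z) + lattice (m + (if a then d z z' else 0)).
  move=> zz uI; have [_ _ c0 c1 _] := arc _ _ zz.
  have [->|u0] := eqVneq u 0.
    right; exists false; split=> //.
    by rewrite (lifted_start lifted zz) addr0.
  have [->|u1] := eqVneq u 1.
    right; exists true; split=> //.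
    by rewrite (lifted_end lifted zz) latticeD -addrA [lattice m + _]addrC.
  left; move: uI; rewrite !in_itv /= => /andP[? ?].
  by rewrite !lt_neqAle eq_sym u0 u1; apply/andP; split.
have [sO|[a [ca ea]]] := ends _ _ k s xx sI.
  have [tO|[b [cb _]]] := ends _ _ l t yy tI; last first.
    by have := vert _ _ _ xx _ sO; rewrite ceq cb => /(_ _)/(_ erefl).
  have [[yE y'E]|[yE y'E]] := cross _ _ _ _ xx yy _ _ sO tO ceq; subst.
    have [_ cinj _ _ _] := arc _ _ xx.
    have sE := cinj _ _ sI tI ceq; move: est;
      rewrite sE => /addrI/lattice_inj kl.
    by exists false, false; rewrite kl.
  have [_ cinj _ _ /(_ _ tI) crev] := arc _ _ xx.
  have sE : s = 1 - t by apply: cinj; rewrite ?in_cc1B // ceq crev.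
  move: est; rewrite (lifted_rev lifted xx) -sE -addrA => /addrI.
  rewrite -latticeN -latticeD => /lattice_inj kl.
  by exists true, false; split=> //; rewrite kl addr0 addrAC addNr add0r.
have [tO|[b [_ eb]]] := ends _ _ l t yy tI.
  by have := vert _ _ _ yy _ tO; rewrite -ceq ca => /(_ _)/(_ erefl).
by move: est; rewrite ea eb => /lifted_vertex_inj[? ?]; exists a, b.
Qed.

(** The lift of a walk, traversed at unit speed.  The summands of a walk all
    stand still except for the edge that is being traversed, so continuity needs
    no gluing. *)
Fixpoint curve x q (t : R) : R * R :=
  if q is y :: q' then e x y (clamp 1 t) + (curve y q' (t - 1) - P y) else P x.

Lemma continuous_curve x q : path (@adj G) x q ->
  continuous (fun t => (curve x q t).1) /\ continuous (fun t =>
    (curve x q t).2).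
Proof.
elim: q x => [|y q IH] x /=; first by split=> t; exact: cvg_cst.
move=> /andP[xy /IH[c1 c2]]; have [e1 e2] := lifted_continuous lifted xy.
have clampc (f : R -> R) : continuous f -> continuous (f \o clamp 1).
  by move=> fc t; apply: continuous_comp; [exact: continuous_clamp | exact: fc].
have shiftc (f : R -> R) : continuous f -> continuous (fun t : R => f (t - 1)).
  move=> fc t; apply: continuous_comp; last exact: fc.
  by apply: cvgB; [exact: cvg_id | exact: cvg_cst].
split=> t; apply: cvgD.
- exact: (clampc _ e1).
- by apply: cvgB; [exact: (shiftc _ c1) | exact: cvg_cst].
- exact: (clampc _ e2).
- by apply: cvgB; [exact: (shiftc _ c2) | exact: cvg_cst].
Qed.

Lemma curve_start x q t : path (@adj G) x q -> t <= 0 -> curve x q t = P x.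
Proof.
elim: q x t => //= y q IH x t /andP[xy qy] t0.
rewrite IH //; last by lra.
by rewrite clamp_le0 // (lifted_start lifted xy) subrr addr0.
Qed.

Lemma curve_end x q t : path (@adj G) x q -> (size q)%:R <= t ->
  curve x q t = P (last x q) + lattice (walk_weight d x q).
Proof.
elim: q x t => [|y q IH] x t /=; first by rewrite addr0.
move=> /andP[xy qy]; rewrite -natr1 => qt;
  have q0 : (0 : R) <= (size q)%:R by [].
rewrite clamp_ge //; last by lra.
rewrite (lifted_end lifted xy) IH //; last by lra.
by rewrite latticeD addrC addrA subrK -addrA [lattice _ + lattice _]addrC.
Qed.

Lemma curve_on_edge x q t : path (@adj G) x q -> q != [::] ->
  t \in `[0, (size q)%:R] -> exists q1 y q2 s,
  [/\ q = q1 ++ y :: q2, adj (last x q1) y, s \in `[0, 1] &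
      curve x q t = e (last x q1) y s + lattice (walk_weight d x q1)].
Proof.
elim: q x t => //= y q IH x t /andP[xy qy] _;
  rewrite in_itv /= -natr1 => /andP[t0 tq].
have [t1|t1] := lerP t 1.
  exists [::], y, q, t; split=> //; first by rewrite in_itv /= t0.
  by rewrite curve_start ?subr_le0 // subrr !addr0 clamp_in // in_itv /= t0.
have q0 : q != [::].
  by apply/eqP => q0; move: tq; rewrite q0 /= add0r; lra.
have [|q1 [z [q2 [s [qE adjz sI cE]]]]] := IH y (t - 1) qy q0.
  by rewrite in_itv /=; apply/andP; split; lra.
exists (y :: q1), z, q2, s; split=> //=; first by rewrite qE.
rewrite clamp_ge ?ltW // (lifted_end lifted xy) cE latticeD.
by rewrite addrC addrA subrK -addrA [lattice _ + lattice _]addrC.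
Qed.

End LiftedWalks.

(** * Independent closed walks on the torus meet *)

Definition repeat_walk (T : Type) (n : nat) (q : seq T) : seq T :=
  flatten (nseq n q).

Lemma size_repeat_walk (T : Type) n (q : seq T) :
  size (repeat_walk n q) = (n * size q)%N.
Proof. by rewrite size_flatten /shape map_nseq sumn_nseq mulnC. Qed.

Lemma last_repeat_walk (T : Type) n (x : T) q :
  last x q = x -> last x (repeat_walk n q) = x.
Proof. by move=> qx; elim: n => //= n IH; rewrite last_cat qx. Qed.

Lemma path_repeat_walk (T : eqType) (r : rel T) n x q :
  path r x q -> last x q = x -> path r x (repeat_walk n q).
Proof. by move=> rq qx; elim: n => //= n IH; rewrite cat_path rq qx. Qed.

Lemma weight_repeat_walk (T : eqType) (V : zmodType) (w : T -> T -> V) n x q :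
  last x q = x -> walk_weight w x (repeat_walk n q) = walk_weight w x q *+ n.
Proof. by move=> qx; elim: n => //= n IH;
  rewrite walk_weight_cat qx IH mulrS. Qed.

Lemma prefix_repeat_walk (T : Type) n (q q1 q2 : seq T) :
  repeat_walk n q = q1 ++ q2 ->
  exists m r1 r2, q = r1 ++ r2 /\ q1 = repeat_walk m q ++ r1.
Proof.
elim: n q1 => [|n IH] q1 /=.
  by case: q1 => // _; exists 0%N, [::], q.
have -> : repeat_walk n.+1 q = q ++ repeat_walk n q by [].
move=> qE; have [sq|sq] := leqP (size q1) (size q).
  exists 0%N, q1, (drop (size q1) q); split=> //.
  have := congr1 (take (size q1)) qE;
    rewrite [take _ (q1 ++ q2)]take_size_cat // take_cat.
  case: ltnP => [_ {1}<-|sq']; first by rewrite cat_take_drop.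
  have s0 : size q1 = size q by apply/eqP; rewrite eqn_leq sq.
  by rewrite s0 subnn take0 cats0 drop_size => <-; rewrite cats0.
have [q1' q1E] : exists q1', q1 = q ++ q1'.
  exists (drop (size q) q1); have := congr1 (take (size q)) qE.
  by rewrite take_size_cat // take_cat sq => {1}->; rewrite cat_take_drop.
move: qE; rewrite q1E -catA => /(congr1 (drop (size q)));
  rewrite !drop_size_cat //.
by move=> /IH[m [r1 [r2 [rE ->]]]]; exists m.+1, r1, r2; rewrite catA.
Qed.

Section ClosedWalks.
Variables (R : realType) (G : sgraph) (p : G -> torus R)
  (c : G -> G -> R -> torus R) (P : G -> R * R) (e : G -> G -> R -> R * R)
  (d : G -> G -> int * int).
Hypothesis lifted : lifted_drawing p c P e d.
Local Notation lattice := (lattice R).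
Local Notation weight := (walk_weight d).
Implicit Types (x y : G) (q r : seq G) (k l v : int * int).

Definition lin (a b : R) (z : R * R) : R := a * z.1 + b * z.2.

Lemma linD a b z w : lin a b (z + w) = lin a b z + lin a b w.
Proof. by rewrite /lin /= !mulrDr addrACA. Qed.

Lemma linN a b z : lin a b (- z) = - lin a b z.
Proof. by rewrite /lin /= !mulrN -opprD. Qed.

Lemma lin_lattice_muln a b k n :
  lin a b (lattice (k *+ n)) = lin a b (lattice k) *+ n.
Proof.
elim: n => [|n IH]; first by rewrite /lin /= !mulr0 addr0.
by rewrite !mulrS latticeD linD IH.
Qed.

Lemma continuous_lin a b (f : R -> R * R) :
  continuous (fun t => (f t).1) -> continuous (fun t => (f t).2) ->
  continuous (fun t => lin a b (f t)).
Proof.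
move=> f1 f2 t; apply: cvgD; apply: cvgM; try exact: cvg_cst.
  exact: f1.
exact: f2.
Qed.

Lemma lifted_arcs_bounded a b : exists B, forall x y, adj x y ->
  {in `[0, 1], forall t, `|lin a b (e x y t)| <= B}.
Proof.
have bound x y : {B | adj x y -> {in `[0, 1], forall t,
  `|lin a b (e x y t)| <= B}}.
  apply: cid; have [xy|] := boolP (adj x y); last by exists 0.
  have [e1 e2] := lifted_continuous lifted xy.
  have [|t _ tmax] := @EVT_max R (fun t => `|lin a b (e x y t)|) 0 1 ler01.
    apply: continuous_subspaceT => t; apply: cvg_norm; exact: continuous_lin.
  by exists `|lin a b (e x y t)| => _; exact: tmax.
exists (\sum_(xy : G * G) `|sval (bound xy.1 xy.2)|) => x y xy t tI.
apply: le_trans (svalP (bound x y) xy t tI) _; apply: le_trans (ler_norm _) _.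
by rewrite (bigD1 (x, y)) //= lerDl sumr_ge0.
Qed.

(** Whole rounds of a closed walk translate its lift by multiples of its shift,
    which the linear form does not see; its values are thus those on one round.
    *)
Lemma repeated_curve_bounded a b x q : path (@adj G) x q -> last x q = x ->
  q != [::] -> lin a b (lattice (weight x q)) = 0 ->
  exists B, forall n, (0 < n)%N ->
    {in `[0, (size (repeat_walk n q))%:R], forall t,
      `|lin a b (curve P e x (repeat_walk n q) t)| <= B}.
Proof.
move=> xq qx q0 lin0; have [B BP] := lifted_arcs_bounded a b.
pose C := \sum_(i < (size q).+1) `|lin a b (lattice (weight x (take i q)))|.
exists (B + C) => n n0 t tI.
have qn0 : repeat_walk n q != [::].
  by rewrite -size_eq0 size_repeat_walk muln_eq0 negb_or -lt0n n0 size_eq0.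
have [q1 [y [q2 [s [qE adjy sI ->]]]]] :=
  curve_on_edge lifted (path_repeat_walk n xq qx) qn0 tI.
rewrite linD; apply: le_trans (ler_normD _ _) _; apply: lerD; first exact: BP.
have [m [r1 [r2 [rE ->]]]] := prefix_repeat_walk qE.
rewrite walk_weight_cat last_repeat_walk // weight_repeat_walk //.
rewrite latticeD linD lin_lattice_muln lin0 mul0rn add0r.
have r1E : r1 = take (size r1) q by rewrite rE take_size_cat.
have r1s : (size r1 < (size q).+1)%N by rewrite rE size_cat ltnS leq_addr.
by rewrite [in leLHS]r1E /C (bigD1 (Ordinal r1s)) //= lerDl sumr_ge0.
Qed.

(** The lifts of two closed walks with independent shifts, repeated often
    enough, cross like the sides of a parallelogram, whatever lattice vector one
    of them is translated by.  Arcs do not cross, so the walks then pass through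
    a common lift of a vertex. *)
Lemma closed_walks_meet x q y r v :
  path (@adj G) x q -> last x q = x -> path (@adj G) y r -> last y r = y ->
  (weight x q).1 * (weight y r).2 != (weight x q).2 * (weight y r).1 ->
  exists q1 q2 r1 r2 (m n : int), [/\ q = q1 ++ q2, r = r1 ++ r2,
    last x q1 = last y r1 &
    weight x q1 + v + weight x q *~ m = weight y r1 + weight y r *~ n].
Proof.
move=> xq qx yr ry; set W := weight x q; set W' := weight y r => det0.
have q0 : q != [::] by apply: contraNneq det0; rewrite /W => -> /=;
  rewrite !mul0r.
have r0 : r != [::] by apply: contraNneq det0; rewrite /W' => -> /=;
  rewrite !mulr0.
pose D : R := W.1%:~R * W'.2%:~R - W.2%:~R * W'.1%:~R.
have D0 : D != 0 by rewrite subr_eq0 -!intrM eqr_int.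
(* The coordinates in the basis [W], [W']. *)
pose f1 := lin (W'.2%:~R / D) (- W'.1%:~R / D).
pose f2 := lin (- W.2%:~R / D) (W.1%:~R / D).
have f1W : f1 (lattice W) = 1.
  by rewrite /f1 /lin /D /=; move: D0; rewrite /D;
    move: (W.1%:~R : R) (W.2%:~R : R) (W'.1%:~R : R) (W'.2%:~R :
      R) => ? ? ? ? ?; field.
have f2W' : f2 (lattice W') = 1.
  by rewrite /f2 /lin /D /=; move: D0; rewrite /D;
    move: (W.1%:~R : R) (W.2%:~R : R) (W'.1%:~R : R) (W'.2%:~R :
      R) => ? ? ? ? ?; field.
have f1W' : f1 (lattice W') = 0 by rewrite /f1 /lin /=; ring.
have f2W : f2 (lattice W) = 0 by rewrite /f2 /lin /=; ring.
have f12 z w : f1 z = f1 w -> f2 z = f2 w -> z = w.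
  have zE (u : R * R) : u =
    (f1 u * W.1%:~R + f2 u * W'.1%:~R, f1 u * W.2%:~R + f2 u * W'.2%:~R).
    rewrite [LHS]surjective_pairing /f1 /f2 /lin /D; move: D0; rewrite /D.
    by move: (W.1%:~R : R) (W.2%:~R : R) (W'.1%:~R : R) (W'.2%:~R :
      R) => ? ? ? ? ?; congr pair; field.
  by move=> h1 h2; rewrite [z]zE [w]zE h1 h2.
have [B1 B1P] := repeated_curve_bounded yr ry r0 f1W'.
have [B2 B2P] := repeated_curve_bounded xq qx q0 f2W.
(* The repeated walks are translated back by [M * W] and [M' * W'], half of
   their total shift, so that each of them starts below and ends above the
   bounded coordinate of the other one. *)
pose M := (Num.truncn (B1 + `|f1 (P x)| + `|f1 (lattice v)|)).+1.
pose M' := (Num.truncn (B2 + `|f2 (P y)| + `|f2 (lattice v)|)).+1.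
have MP : B1 + `|f1 (P x)| + `|f1 (lattice v)| < M%:R by exact: truncnS_gt.
have MP' : B2 + `|f2 (P y)| + `|f2 (lattice v)| < M'%:R by exact: truncnS_gt.
pose Q := repeat_walk (M + M) q; pose S := repeat_walk (M' + M') r.
have xQ : path (@adj G) x Q by exact: path_repeat_walk.
have yS : path (@adj G) y S by exact: path_repeat_walk.
have Q0 : Q != [::] by rewrite -size_eq0 size_repeat_walk muln_eq0 negb_or
  size_eq0 q0.
have S0 : S != [::] by rewrite -size_eq0 size_repeat_walk muln_eq0 negb_or
  size_eq0 r0.
have [cQ1 cQ2] := continuous_curve lifted xQ.
have [cS1 cS2] := continuous_curve lifted yS.
have Qend : curve P e x Q (size Q)%:R = P x + lattice (W *+ (M + M)).
  by rewrite (curve_end lifted xQ) // last_repeat_walk // weight_repeat_walk.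
have Send : curve P e y S (size S)%:R = P y + lattice (W' *+ (M' + M')).
  by rewrite (curve_end lifted yS) // last_repeat_walk // weight_repeat_walk.
pose A s := curve P e x Q s + lattice (v + W *- M).
pose B t := curve P e y S t + lattice (W' *- M').
have f1D z w : f1 (z + w) = f1 z + f1 w by exact: linD.
have f2D z w : f2 (z + w) = f2 z + f2 w by exact: linD.
have f1WM n : f1 (lattice (W *+ n)) =
  n%:R by rewrite /f1 lin_lattice_muln -/f1 f1W.
have f2WM n : f2 (lattice (W *+ n)) =
  0 by rewrite /f2 lin_lattice_muln -/f2 f2W mul0rn.
have f1WM' n : f1 (lattice (W' *+ n)) =
  0 by rewrite /f1 lin_lattice_muln -/f1 f1W' mul0rn.
have f2WM' n : f2 (lattice (W' *+ n)) =
  n%:R by rewrite /f2 lin_lattice_muln -/f2 f2W'.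
have f1A s : f1 (A s) = f1 (curve P e x Q s) + (f1 (lattice v) - M%:R).
  by rewrite /A latticeD latticeN -(f1WM M) -linN -!linD.
have f2A s : f2 (A s) = f2 (curve P e x Q s) + f2 (lattice v).
  rewrite /A latticeD latticeN -[f2 (lattice v)]subr0 -(f2WM M).
  by rewrite -linN -!linD.
have f1B t : f1 (B t) = f1 (curve P e y S t).
  by rewrite /B latticeN -[RHS]subr0 -(f1WM' M') -linN -linD.
have f2B t : f2 (B t) = f2 (curve P e y S t) - M'%:R.
  by rewrite /B latticeN -(f2WM' M') -linN -linD.
have [||||||||s [t [sI tI h1 h2]]] := @paths_meet R (f1 \o A) (f2 \o A)
  (f1 \o B) (f2 \o B)
  (size Q)%:R (size S)%:R.
- have -> : f1 \o A = (fun s => f1 (curve P e x Q s) + (f1 (lattice v) - M%:R)).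
    by apply/funext => s; rewrite /= f1A.
  by move=> s; apply: cvgD; [exact: continuous_lin | exact: cvg_cst].
- have -> : f2 \o A = (fun s => f2 (curve P e x Q s) + f2 (lattice v)).
    by apply/funext => s; rewrite /= f2A.
  by move=> s; apply: cvgD; [exact: continuous_lin | exact: cvg_cst].
- have -> : f1 \o B = (fun s => f1 (curve P e y S s)).
    by apply/funext => s; rewrite /= f1B.
  exact: continuous_lin.
- have -> : f2 \o B = (fun s => f2 (curve P e y S s) - M'%:R).
    by apply/funext => s; rewrite /= f2B.
  by move=> s; apply: cvgB; [exact: continuous_lin | exact: cvg_cst].
- by rewrite ltr0n lt0n size_eq0.
- by rewrite ltr0n lt0n size_eq0.
- move=> t tI; rewrite /= !f1A f1B Qend (curve_start lifted xQ) // f1D f1WM.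
  have := B1P _ (ltn0Sn _ : 0 < M' + M')%N _ tI; rewrite -/S -/f1 natrD.
  move: MP; have := ler_norm (f1 (P x)); have := ler_norm (- f1 (P x)).
  have := ler_norm (f1 (lattice v)); have := ler_norm (- f1 (lattice v)).
  rewrite !normrN ler_norml => ? ? ? ? ? /andP[? ?]; apply/andP; split; lra.
- move=> s sI; rewrite /= !f2B f2A Send (curve_start lifted yS) // f2D f2WM'.
  have := B2P _ (ltn0Sn _ : 0 < M + M)%N _ sI; rewrite -/Q -/f2 natrD.
  move: MP'; have := ler_norm (f2 (P y)); have := ler_norm (- f2 (P y)).
  have := ler_norm (f2 (lattice v)); have := ler_norm (- f2 (lattice v)).
  rewrite !normrN ler_norml => ? ? ? ? ? /andP[? ?]; apply/andP; split; lra.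
have AB := f12 _ _ h1 h2.
have [q1 [z [q2 [s' [QE adjz s'I sE]]]]] := curve_on_edge lifted xQ Q0 sI.
have [r1 [w [r2 [t' [SE adjw t'I tE]]]]] := curve_on_edge lifted yS S0 tI.
move: AB; rewrite /A /B sE tE -!addrA -!latticeD.
move=> /(lifted_arcs_meet lifted adjz adjw s'I t'I)[a [b [vE wE]]].
have ends u (o : seq G) (g : bool) h o' :
    exists o1 o2, [/\ o ++ h :: o' = o1 ++ o2, (if g then h else last u o) =
      last u o1 &
      weight u o + (if g then d (last u o) h else 0) = weight u o1].
  case: g; last by exists o, (h :: o'); rewrite addr0.
  exists (rcons o h), o';
    rewrite cat_rcons last_rcons -cats1 walk_weight_cat /= addr0.
  by split.
(* The common vertex of two edges on the repeated walks is the end of an initial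
   part of each, which consists of whole rounds and of an initial part of the
   original walk. *)
have [Q1 [Q2 [QQ Qv QW]]] := ends x q1 a z q2.
have [S1 [S2 [SS Sv SW]]] := ends y r1 b w r2.
rewrite Qv Sv in vE; rewrite addrAC QW [RHS]addrAC SW in wE.
have [m [p1 [p2 [qE Q1E]]]] := prefix_repeat_walk (etrans QE QQ).
have [n [u1 [u2 [rE S1E]]]] := prefix_repeat_walk (etrans SE SS).
exists p1, p2, u1, u2, (m%:Z - M%:Z), (n%:Z - M'%:Z); split=> //.
  by move: vE; rewrite Q1E S1E !last_cat !last_repeat_walk.
move: wE; rewrite Q1E S1E !walk_weight_cat !last_repeat_walk //
  !weight_repeat_walk //.
rewrite -/W -/W' !mulrzBr -!pmulrn => wE.
rewrite [RHS]addrA [weight y u1 + _]addrC -wE !addrA; congr (_ - _).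
by rewrite addrC addrA.
Qed.

End ClosedWalks.

(** * The width of a closed walk *)

(** The coordinates of [c] are those of [W] divided by their greatest common
    divisor, and [v] comes from the Bezout coefficients. *)
Lemma primitive_direction (W : int * int) : W != 0 ->
  exists (c v : int * int) (g : int),
    [/\ g != 0, W = (g * c.1, g * c.2) & v.1 * c.2 - v.2 * c.1 = 1].
Proof.
case: W => a b W0; pose g := gcdz a b.
have g0 : g != 0.
  apply: contraNneq W0 => /eqP; rewrite gcdz_eq0 => /andP[/eqP -> /eqP ->].
  exact: eqxx.
have ag : a = g * (a %/ g)%Z by rewrite mulrC divzK // dvdz_gcdl.
have bg : b = g * (b %/ g)%Z by rewrite mulrC divzK // dvdz_gcdr.
have [u [v uv]] := Bezoutz a b.
exists ((a %/ g)%Z, (b %/ g)%Z), (v, - u), g; split=> //=;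
  first by rewrite -ag -bg.
apply: (mulfI g0); rewrite mulr1 -[RHS]uv {2}ag {2}bg.
by move: (a %/ g)%Z (b %/ g)%Z => a' b'; ring.
Qed.

(** The height of [k] above the line of [c], in the unit in which the lattice
    points next to this line have height [1] if [c] is primitive. *)
Definition rise (c k : int * int) : int := k.1 * c.2 - k.2 * c.1.

Lemma riseD c k l : rise c (k + l) = rise c k + rise c l.
Proof. by rewrite /rise /=; ring. Qed.

Lemma riseN c k : rise c (- k) = - rise c k.
Proof. by rewrite /rise /=; ring. Qed.

Lemma riseMz c k m : rise c (k *~ m) = rise c k * m.
Proof.
have nat n : rise c (k *+ n) = rise c k * n%:Z.
  elim: n => [|n IH]; first by rewrite /rise /= !mul0r subr0 mulr0.
  by rewrite mulrS riseD IH intS; ring.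
case: m => n; first by rewrite -pmulrn nat.
by rewrite NegzE mulrNz riseN -pmulrn nat mulrN.
Qed.

Section Width.
Variables (R : realType) (G : sgraph) (p : G -> torus R)
  (a : G -> G -> R -> torus R) (P : G -> R * R) (e : G -> G -> R -> R * R)
  (d : G -> G -> int * int).
Hypothesis lifted : lifted_drawing p a P e d.
Local Notation weight := (walk_weight d).

(** A vertex of a simple closed walk is met at one time only, up to full rounds,
    which do not rise. *)
Lemma simple_closed_walk_rise (x : G) q q1 q2 q1' q2' c :
  uniq q -> last x q = x -> rise c (weight x q) = 0 ->
  q = q1 ++ q2 -> q = q1' ++ q2' -> last x q1 = last x q1' ->
  rise c (weight x q1) = rise c (weight x q1').
Proof.
move=> uq qx tq.
have tnil : rise c (weight x [::]) = 0 by rewrite /rise /= !mul0r subr0.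
have full q3 q4 : q = q3 ++ q4 -> last x q3 = x -> rise c (weight x q3) = 0.
  case/lastP: q3 => [//|q3 z]; rewrite last_rcons => qE zx.
  case/lastP: q4 qE => [|q4 w] qE; first by rewrite -[rcons q3 z]cats0 -qE.
  move: uq qx; rewrite qE last_cat !last_rcons cat_uniq =>
    /and3P[_ /hasPn/(_ w) + _] wx.
  by rewrite !mem_rcons !inE eqxx wx zx eqxx => /(_ isT).
move=> qE qE' ll; have [lx|lx] := eqVneq (last x q1) x.
  by rewrite (full _ _ qE lx) (full _ _ qE') // -ll.
have index_last q3 q4 :
  q = q3 ++ q4 -> last x q3 != x -> q3 = take (index (last x q3) q).+1 q.
  case/lastP: q3 => [|q3 z] q34; first by rewrite eqxx.
  rewrite last_rcons => zx.
  have -> : index z q = size q3.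
    move: uq; rewrite q34 cat_uniq rcons_uniq => /and3P[/andP[zq _] _ _].
    by rewrite cat_rcons index_cat (negbTE zq) /= eqxx addn0.
  by rewrite q34 take_size_cat // size_rcons.
by rewrite (index_last _ _ qE lx) (index_last _ _ qE') -?ll.
Qed.

(** The lifts of a simple closed walk in the direction [c] that are translated
    to different heights have no vertex in common, and a closed walk that rises
    by [h] passes through a vertex of each of [h] consecutive ones.  Assigning
    to each of them the time of such a passage is therefore injective. *)
Lemma closed_walk_width (x : G) q c v (y : G) r :
  path (@adj G) x q -> last x q = x -> uniq q ->
  weight x q != 0 -> rise c (weight x q) = 0 -> rise c v = 1 ->
  path (@adj G) y r -> last y r = y ->
  (`|rise c (weight y r)| <= size r)%N.
Proof.
move=> xq qx uq W0 tq tv yr ry; set h := rise c (weight y r).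
have [->//|h0] := eqVneq h 0.
have det0 : (weight x q).1 * (weight y r).2 != (weight x q).2 * (weight y r).1.
  apply: contraNneq W0 => det0; apply/eqP.
  move: tq; rewrite /rise => tq.
  have h1 : (weight x q).1 * h = 0.
    transitivity ((weight y r).1 * ((weight x q).1 * c.2 - (weight x q).2 *
      c.1) +
      c.1 * ((weight x q).2 * (weight y r).1 - (weight x q).1 * (weight y
        r).2)).
      by rewrite /h /rise; ring.
    by rewrite tq det0 subrr !mulr0.
  have h2 : (weight x q).2 * h = 0.
    transitivity ((weight y r).2 * ((weight x q).1 * c.2 - (weight x q).2 *
      c.1) +
      c.2 * ((weight x q).2 * (weight y r).1 - (weight x q).1 * (weight y
        r).2)).
      by rewrite /h /rise; ring.
    by rewrite tq det0 subrr !mulr0.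
  move/eqP: h1; move/eqP: h2;
    rewrite !mulf_eq0 (negbTE h0) !orbF => /eqP w2 /eqP w1.
  by rewrite [LHS]surjective_pairing w1 w2.
have r0 : (0 < size r)%N.
  rewrite lt0n size_eq0; apply: contraNneq h0 => r0.
  by rewrite /h r0 /rise /= !mul0r subr0.
have meet (j : 'I_(`|h|%N)) : exists i : 'I_(size r), exists q1 q2 r1 r2 (n :
  int),
    [/\ q = q1 ++ q2, r = r1 ++ r2, size r1 = i, last x q1 = last y r1 &
    rise c (weight x q1) + j%:Z = rise c (weight y r1) + h * n].
  have [q1 [q2 [r1 [r2 [m [n [qE rE qr W]]]]]]] :=
    closed_walks_meet lifted (v *~ j) xq qx yr ry det0.
  have := congr1 (rise c) W.
  rewrite !riseD !riseMz tq tv mul0r addr0 mul1r -/h => tE.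
  have [r1r|r1r] := leqP (size r) (size r1); last first.
    by exists (Ordinal r1r), q1, q2, r1, r2, n.
  (* The end of the closed walk is its start, one round later. *)
  have r1E : r1 = r.
    rewrite rE; have : size r2 = 0%N by move: r1r; rewrite rE size_cat; lia.
    by move/size0nil ->; rewrite cats0.
  exists (Ordinal r0), q1, q2, [::], r, (n + 1); split=> //;
    first by rewrite qr r1E ry.
  by rewrite tE r1E -/h /rise /= !mul0r subr0; ring.
have [f fP] := choice meet.
suff f_inj : injective f by have := leq_card f f_inj; rewrite !card_ord.
move=> j j' ff.
have [q1 [q2 [r1 [r2 [n [qE rE sr qr tE]]]]]] := fP j.
have [q1' [q2' [r1' [r2' [n' [qE' rE' sr' qr' tE']]]]]] := fP j'.
have rr : r1 = r1'.
  rewrite -[LHS](take_size_cat r2 (erefl _))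
    -[RHS](take_size_cat r2' (erefl _)).
  by rewrite -rE -rE' sr sr' ff.
have tq1 : rise c (weight x q1) = rise c (weight x q1').
  by apply: simple_closed_walk_rise uq qx tq qE qE' _; rewrite qr qr' rr.
have jj : j%:Z - j'%:Z = h * (n - n') by move: tE tE'; rewrite tq1 rr; lia.
apply/val_inj => /=; have [nn|nn] := eqVneq (n - n') 0.
  by move: jj; rewrite nn mulr0; lia.
have : (`|h| <= `|j%:Z - j'%:Z|)%N by rewrite jj abszM leq_pmulr // absz_gt0.
by have := ltn_ord j; have := ltn_ord j'; lia.
Qed.

(** By [closed_walk_width], no closed walk becomes negative when [1] is added to
    the rise of each of its arcs.  The resulting potential bounds the renumbered
    rise of an arc from one side, and that of the reverse arc from the other. *)
Lemma torus_potential :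
  (forall x q, path (@adj G) x q -> last x q = x -> weight x q = 0) \/
  exists (c v : int * int) (n : G -> int), v.1 * c.2 - v.2 * c.1 = 1 /\
    forall x y, adj x y -> `|rise c (d x y) + n x - n y| <= 1.
Proof.
have [flat|] := pselect (forall x q, path (@adj G) x q -> last x q =
  x -> weight x q = 0).
  by left.
move=> /existsNP[x0 /existsNP[q0 /not_implyP[xq0 /not_implyP[qx0 /eqP W0]]]];
  right.
have [x [q [xq qx uq W]]] := simple_closed_walk xq0 qx0 W0.
have [c [v [g [g0 WE vc]]]] := primitive_direction W.
have tq : rise c (weight x q) = 0 by rewrite WE /rise /=; ring.
have [|n nP] := @potential G (@adj G) (fun y z => rise c (d y z) + 1).
  move=> y r yr ry; rewrite walk_weightD walk_weight_const.
  rewrite (walk_weight_additive (f := rise c));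
    [|exact: riseD|by rewrite /rise /= !mul0r subr0].
  have := closed_walk_width xq qx uq W tq vc yr ry;
    rewrite -[1 *+ _]/((size r)%:R) natz; lia.
exists c, v, n; split=> // y z yz.
have := nP y z yz; have := nP z y;
  rewrite adj_sym (lifted_shift_rev lifted yz) => /(_ yz).
rewrite riseN; lia.
Qed.

End Width.

(** * The torus *)

Section Annulus.
Variables (R : realType) (c v : int * int).
Hypothesis basis : v.1 * c.2 - v.2 * c.1 = 1.
Local Notation lattice := (lattice R).

(** The coordinates in the basis [v], [c]. *)
Let height : R * R -> R := lin c.2%:~R (- c.1%:~R).
Let angle : R * R -> R := lin (- v.2%:~R) v.1%:~R.

Let basisR : v.1%:~R * c.2%:~R - v.2%:~R * c.1%:~R = 1 :> R.
Proof. by rewrite -!intrM -intrB basis. Qed.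

Let coordinates z w : height z = height w -> angle z = angle w -> z = w.
Proof.
have zE (u : R * R) : u = (height u * v.1%:~R + angle u * c.1%:~R,
                           height u * v.2%:~R + angle u * c.2%:~R).
  rewrite [LHS]surjective_pairing /height /angle /lin; move: basisR.
  move: (c.1%:~R : R) (c.2%:~R : R) (v.1%:~R : R) (v.2%:~R :
    R) => c1 c2 v1 v2 b.
  by congr pair; rewrite -[LHS]mulr1 -b; ring.
by move=> h1 h2; rewrite [z]zE [w]zE h1 h2.
Qed.

Let height_lattice z k : height (z + lattice k) = height z + (rise c k)%:~R.
Proof.
rewrite [LHS]linD; congr (_ + _).
by rewrite /lin /rise /= intrB !intrM; ring.
Qed.

Let angle_lattice z k : angle (z + lattice k) = angle z - (rise v k)%:~R.
Proof.
rewrite [LHS]linD; congr (_ + _).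
by rewrite /lin /rise /= intrB !intrM; ring.
Qed.

(** The quotient of the plane by the translation along [c] is an open annulus,
    and the exponential map lays it out as the punctured plane. *)
Definition annulus_map (z : R * R) : plane R :=
  point2 (expR (height z) * cos (2 * pi * angle z))
         (expR (height z) * sin (2 * pi * angle z)).

Lemma annulus_map_inj z w : annulus_map z = annulus_map w ->
  exists m : int, w = z + lattice (c *~ m).
Proof.
move=> /point2_inj[hc hs].
have hE : expR (height z) = expR (height w).
  have sq u : (expR (height u)) ^+ 2 =
    (expR (height u) * cos (2 * pi * angle u)) ^+ 2 +
     (expR (height u) * sin (2 * pi * angle u)) ^+ 2.
    by rewrite !exprMn -mulrDr cos2Dsin2 mulr1.
  have /eqP : (expR (height z)) ^+ 2 =
    (expR (height w)) ^+ 2 by rewrite !sq hc hs.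
  by rewrite eqrXn2 // ?expR_ge0 // => /eqP.
have e0 : expR (height w) != 0 by rewrite gt_eqF // expR_gt0.
rewrite hE in hc hs.
have [m mE] := cos_sin_2pi_eq (esym (mulfI e0 hc)) (esym (mulfI e0 hs)).
exists m; apply: coordinates.
  rewrite height_lattice riseMz (expR_inj hE).
  by rewrite [rise c c](_ : _ = 0) ?mul0r ?addr0 // /rise; ring.
rewrite angle_lattice riseMz mE [rise v c](_ : _ = -1).
  by rewrite mulN1r mulrNz opprK.
by rewrite -basis /rise; ring.
Qed.

Lemma annulus_map_lattice z k : rise c k = 0 ->
  annulus_map (z + lattice k) = annulus_map z.
Proof.
move=> tk; rewrite /annulus_map height_lattice angle_lattice tk addr0 -mulrNz.
by have [-> ->] := cos_sin_2piD_int (angle z) (- rise v k).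
Qed.

Lemma continuous_annulus_map (f : R -> R * R) :
  continuous (fun t => (f t).1) -> continuous (fun t => (f t).2) ->
  continuous (fun t => annulus_map (f t)).
Proof.
move=> f1 f2.
have hc : continuous (fun t => expR (height (f t))).
  move=> t; apply: (@continuous_comp _ _ _ (fun t => height (f t)) expR).
    exact: continuous_lin.
  exact: continuous_expR.
have ac : continuous (fun t => 2 * pi * angle (f t)).
  by move=> t; apply: cvgM; [exact: cvg_cst | exact: continuous_lin].
apply: continuous_point2 => t; apply: cvgM; try exact: hc.
  apply: (@continuous_comp _ _ _ (fun t => 2 * pi * angle (f t)) cos);
    first exact: ac.
  exact: continuous_cos.
apply: (@continuous_comp _ _ _ (fun t => 2 * pi * angle (f t)) sin);
  first exact: ac.
exact: continuous_sin.
Qed.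

End Annulus.

(** If no closed walk of the graph goes around the torus, the lifts of the
    vertices can be chosen so that all arcs close up in the plane.  Otherwise
    they can be chosen so that every arc rises by at most [1] in the annulus
    that covers the torus along some closed walk; two consecutive lifts of each
    vertex then carry a lift of every edge. *)
Lemma splittable_torus (R : realType) (G : sgraph) :
  embeddable R (torus R) G -> splittable R 2 G.
Proof.
move=> [p [a drawn]]; have [P [e [d lifted]]] := lifted_drawing_exists drawn.
have shift_cont (f : R -> R * R) k :
    continuous (fun t => (f t).1) /\ continuous (fun t => (f t).2) ->
    continuous (fun t => (f t + lattice R k).1) /\ continuous (fun t =>
      (f t + lattice R k).2).
  by move=> [f1 f2]; split=> t; (apply: cvgD; last exact: cvg_cst);
    [exact: f1 | exact: f2].
have [flat|[c [v [n [basis rise1]]]]] := torus_potential lifted.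
  have flat1 x q : path (@adj G) x q -> last x q = x ->
      walk_weight (fun y z => (d y z).1) x q = 0.
    by move=> xq qx; rewrite (walk_weight_additive (f := fst)) // flat.
  have flat2 x q : path (@adj G) x q -> last x q = x ->
      walk_weight (fun y z => (d y z).2) x q = 0.
    by move=> xq qx; rewrite (walk_weight_additive (f := snd)) // flat.
  have [|m1 m1P] := potential_eq (@adj_sym G) _ flat1.
    by move=> x y xy; rewrite (lifted_shift_rev lifted xy).
  have [|m2 m2P] := potential_eq (@adj_sym G) _ flat2.
    by move=> x y xy; rewrite (lifted_shift_rev lifted xy).
  (* The lift of [x] that makes all arcs close up is translated by [m x]. *)
  pose m x := (m1 x, m2 x).
  have dE x y : adj x y -> d x y + m x = m y.
    move=> xy; rewrite [RHS]surjective_pairing [LHS]surjective_pairing /=.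
    by rewrite m1P // m2P // !subrK.
  pose f (z : R * R) : plane R := point2 z.1 z.2.
  have f_inj z w : f z = f w -> z = w.
    by move=> /point2_inj[h1 h2];
      rewrite [z]surjective_pairing [w]surjective_pairing h1 h2.
  apply: splittable_planar.
  apply: (@embeddable_lift R (plane R) (torus R) G G p a id
    (fun w y => exists2 z, w = f z & covers z y)
    (fun x => f (P x + lattice R (m x))) (fun x y t =>
      f (e x y t + lattice R (m x))) drawn) => //.
  - by move=> w y y' [z -> zy] [z' /f_inj <- zy']; exact: covers_unique zy zy'.
  - by move=> x y /f_inj /(lifted_vertex_inj lifted)[].
  - by move=> x; exists (P x + lattice R (m x)) => //; apply: covers_lattice;
      exact: (lifted_vertex lifted x).
  - move=> x y xy _; split.
    + have [e1 e2] := shift_cont _ (m x) (lifted_continuous lifted xy).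
      exact: continuous_point2.
    + by rewrite (lifted_start lifted xy).
    + by rewrite (lifted_end lifted xy) -addrA -latticeD dE.
    + move=> t tI; exists (e x y t + lattice R (m x)) => //;
        apply: covers_lattice.
      exact: (lifted_covers lifted xy tI).
pose f := @annulus_map R c v.
(* The copies of [x] are its lifts to the annulus at the heights [n x] and [n x
   + 1] relative to the chosen lift. *)
pose level x (b : bool) : int := n x + b%:Z.
pose hadj (h h' : G * bool) :=
  adj h.1 h'.1 && (level h'.1 h'.2 == level h.1 h.2 + rise c (d h.1 h'.1)).
have hsym : symmetric hadj.
  move=> h h'; rewrite /hadj adj_sym; have [hh|//] := boolP (adj _ _).
  rewrite (lifted_shift_rev lifted hh) riseN /=.
  by apply/eqP/eqP; lia.
have hirr : irreflexive hadj by move=> h; rewrite /hadj adj_irr.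
pose H := SGraph hsym hirr.
pose lev (h : H) : int * int := v *~ level h.1 h.2.
have rise_v : rise c v = 1 by [].
have rise_lev h : rise c (lev h) = level h.1 h.2 by rewrite riseMz rise_v mul1r.
apply: (@splittable_cover R 2 G H fst).
- by move=> h h' /andP[].
- move=> x y xy.
  (* An arc whose renumbered rise is [1] leads from the lower copy to the upper
     one, one whose rise is [-1] from the upper to the lower one; otherwise the
     lower copies serve. *)
  exists (x, n y == n x + rise c (d x y) + 1), (y,
    n y == n x + rise c (d x y) - 1); split=> //=.
  rewrite /hadj /= xy /= /level; have := rise1 _ _ xy => ?.
  case: (n y =P n x + rise c (d x y) + 1) => ?;
    case: (n y =P n x + rise c (d x y) - 1) => ?; apply/eqP => /=; lia.
- move=> x; apply: leq_trans (_ : #|[set (x, false); (x, true)]%SET| <= 2)%N.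
    apply/subset_leq_card/fintype.subsetP => -[w b]; rewrite !inE /= => /eqP ->.
    by case: b; rewrite eqxx ?orbT.
  by rewrite cards2; case: eqP.
have f_fibre z w k l : f (z + lattice R k) = f (w + lattice R l) ->
    exists m, w + lattice R l = z + lattice R (k + c *~ m).
  by move=> /(annulus_map_inj basis)[m ->]; exists m; rewrite latticeD addrA.
have rise_c m : rise c (c *~ m) = 0 by rewrite riseMz [rise c c](_ :
  _ = 0) ?mul0r // /rise; ring.
apply: (@embeddable_lift R (plane R) (torus R) G H p a (fst : H -> G)
  (fun w y => exists2 z, w = f z & covers z y)
  (fun h => f (P h.1 + lattice R (lev h)))
  (fun h h' t => f (e h.1 h'.1 t + lattice R (lev h))) drawn).
- by move=> h h' /andP[].
- move=> w y y' [z -> zy] [z' /(annulus_map_inj basis)[m z'E] zy'].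
  by apply: covers_unique (covers_lattice (c *~ m) zy) _; rewrite -z'E.
- move=> [x b] [y b'] /= /f_fibre[m /(lifted_vertex_inj lifted)[yx /(congr1
    (rise c))]].
  rewrite riseD rise_c addr0 !rise_lev /= yx /level => /addrI [bb].
  by congr pair; case: b b' bb => [] [].
- by move=> h; exists (P h.1 + lattice R (lev h)) => //; apply: covers_lattice;
    exact: (lifted_vertex lifted h.1).
- move=> h h' /andP[hh /eqP lE] _; split.
  + have [e1 e2] := shift_cont _ (lev h) (lifted_continuous lifted hh).
    exact: continuous_annulus_map.
  + by rewrite (lifted_start lifted hh).
  + rewrite (lifted_end lifted hh) -addrA -latticeD.
    have -> : d h.1 h'.1 + lev h = lev h' + (d h.1 h'.1 + lev h - lev h').
      by rewrite [RHS]addrC subrK.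
    rewrite latticeD addrA; apply: annulus_map_lattice.
    by rewrite !riseD riseN !rise_lev lE; ring.
  + move=> t tI; exists (e h.1 h'.1 t + lattice R (lev h)) => //;
      apply: covers_lattice.
    exact: (lifted_covers lifted hh tI).
- move=> h h' k k' /andP[_ /eqP hE] /andP[_ /eqP kE] _ hk hk' t tI.
  rewrite hk hk' => /f_fibre[m /addrI/lattice_inj/(congr1 (rise c))].
  rewrite riseD rise_c addr0 !rise_lev => lE.
  have bE (u w : bool) (i : int) : i + u%:Z = i + w%:Z -> u = w.
    by case: u w => [] [] //; lia.
  have h2 : h.2 = k.2 by apply: (bE _ _ (n k.1)); move: lE; rewrite /level hk.
  have h2' : h'.2 = k'.2.
    by apply: (bE _ _ (n k'.1)); move: hE kE lE;
      rewrite /level hk hk' => -> -> ->.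
  by split; [rewrite [h]surjective_pairing hk h2 -surjective_pairing
           | rewrite [h']surjective_pairing hk' h2' -surjective_pairing].
Qed.

Theorem theorem4 (R : realType) (G : sgraph)
    (hG : embeddable R (torus R) G \/ embeddable R (projective_plane R) G) :
  splittable R 2 G.
Proof.
by case: hG; [exact: splittable_torus | exact: splittable_projective_plane].
Qed.
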